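(* Let $k$ be a positive integer, $j\in\{0,1,\dots,k\}$, and $w\in W^j$. Then $$D_{\Lambda_j}(\mathbf{u}_w)=\sum_{z\lessdot w} c_z^{w,j}\,\mathbf{u}_z,$$ where, writing a reduced expression $w=s_{i_m}\cdots s_{i_2}s_{i_1}$ such that $s_{i_m}\cdots\widehat{s_{i_\ell}}\cdots s_{i_1}$ is a reduced expression for $z$, the coefficient $c_z^{w,j}$ is the number of addable cells of residue $i_\ell-j$ of the $(k+1)$-core $s_{i_{\ell-1}-j}\cdots s_{i_1-j}\,\emptyset$ (all indices taken modulo $k+1$).
   Context: $I=\{0,1,\dots,k\}$; $i,j\in I$ are adjacent if $i-j\equiv\pm1\pmod{k+1}$. $W$ is the affine symmetric group generated by $s_i$ ($i\in I$) with $s_i^2=1$, $s_is_j=s_js_i$ (non-adjacent), $s_is_js_i=s_js_is_j$ (adjacent). $W_j=\langle s_i:i\ne j\rangle$ and $W^j$ is the set of minimal length coset representatives of $W/W_j$. Bruhat order: $v<w$ if a reduced word of $v$ is a subword of a reduced word of $w$; $z\lessdot w$ means $z<w$ and $\ell(z)=\ell(w)-1$. Root datum of type $A_k^{(1)}$ with simple coroots $\alpha_i^\vee$, simple roots $\alpha_i$, $\langle\alpha_i^\vee,\alpha_j\rangle=2,-1,0$ according as $i=j$, adjacent, otherwise; $W$ acts by $s_i(\lambda)=\lambda-\langle\alpha_i^\vee,\lambda\rangle\alpha_i$, $s_i(\mu)=\mu-\langle\mu,\alpha_i\rangle\alpha_i^\vee$; fundamental weights $\langle\alpha_i^\vee,\Lambda_j\rangle=\delta_{ij}$.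 For $z\lessdot w$, $z^{-1}w=us_iu^{-1}$ and $\alpha^\vee_{z,w}=u(\alpha_i^\vee)$ is the coroot of the positive real root $\alpha_{z,w}=u(\alpha_i)$ with $s_{\alpha_{z,w}}=z^{-1}w$. $\mathbb{A}$ is the nilCoxeter algebra with generators $\mathbf{u}_i$, relations $\mathbf{u}_i^2=0$ and the braid relations of $W$, basis $\mathbf{u}_w$. $D_\Lambda(\mathbf{u}_w)=\sum_{z\lessdot w}\langle\alpha^\vee_{z,w},\Lambda\rangle\mathbf{u}_z$ (extended linearly). The residue of the cell in row $a$, column $b$ of a Young diagram is $(b-a)\bmod (k+1)$. A $(k+1)$-core is a partition with no removable rim hook of length $k+1$. $W$ acts on $(k+1)$-cores $\lambda$ by: $s_i\lambda$ is $\lambda$ with all addable residue-$i$ cells added if $\lambda$ has an addable cell of residue $i$; $\lambda$ with all removable residue-$i$ cells removed if it has a removable cell of residue $i$; and $\lambda$ otherwise.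
   Formalization: For k = 1 the pairing of the two distinct simple roots with each other's coroots is taken to be -2 instead of -1, and no braid relation is imposed on s_0, s_1 (true type A_1^(1), infinite dihedral group); for k ≥ 2 nothing is changed. *)

(* Defs.v *)
From Stdlib Require Import Relation_Operators.
From HB Require Import structures.
From mathcomp Require Import all_boot all_order all_algebra.
From mathcomp Require Import boolp classical_sets cardinality fsbigop.
From mathcomp Require Import freeg zify.

Set Implicit Arguments.
Unset Strict Implicit.
Unset Printing Implicit Defensive.

Import GRing.Theory.

Local Open Scope classical_set_scope.
Local Open Scope quotient_scope.
Local Open Scope ring_scope.

(* The index set is 'I_k.+1, whose zmodType structure is addition modulo
   k + 1. *)
Definition adjacent k (i h : 'I_k.+1) : bool := (h == ordS i) || (i == ordS h).

Lemma adjacent_sym k (i h : 'I_k.+1) : adjacent i h = adjacent h i.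
Proof. by rewrite /adjacent orbC. Qed.

Section AffineWeyl.
Variable k : nat.
Implicit Types (r : seq 'I_k.+1) (i h : 'I_k.+1).

(* For k = 1 the two generators satisfy no braid relation: the Weyl group of
   type A_1^(1) is the infinite dihedral group. *)
Variant weyl_relation : seq 'I_k.+1 -> seq 'I_k.+1 -> Prop :=
| Weyl_sq i : weyl_relation [:: i; i] [::]
| Weyl_comm i h : ~~ adjacent i h -> weyl_relation [:: i; h] [:: h; i]
| Weyl_braid i h : (1 < k)%N -> adjacent i h ->
    weyl_relation [:: i; h; i] [:: h; i; h].

Inductive word_equiv : seq 'I_k.+1 -> seq 'I_k.+1 -> Prop :=
| Word_refl r : word_equiv r r
| Word_sym r1 r2 : word_equiv r1 r2 -> word_equiv r2 r1
| Word_trans r2 r1 r3 :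
    word_equiv r1 r2 -> word_equiv r2 r3 -> word_equiv r1 r3
| Word_step r1 r2 a b : weyl_relation a b ->
    word_equiv (r1 ++ a ++ r2) (r1 ++ b ++ r2).

Definition word_equivb r1 r2 : bool := `[< word_equiv r1 r2 >].

Lemma word_equivb_refl : reflexive word_equivb.
Proof. by move=> r; apply/asboolP; exact: Word_refl. Qed.

Lemma word_equivb_sym : symmetric word_equivb.
Proof. by move=> r1 r2; apply/asboolP/asboolP; exact: Word_sym. Qed.

Lemma word_equivb_trans : transitive word_equivb.
Proof.
by move=> r2 r1 r3 /asboolP h12 /asboolP h23; apply/asboolP/(Word_trans h12).
Qed.

Canonical word_equiv_rel :=
  EquivRel word_equivb word_equivb_refl word_equivb_sym word_equivb_trans.

Definition affW : Type := {eq_quot word_equivb}.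

HB.instance Definition _ : EqQuotient _ word_equivb affW :=
  EqQuotient.on affW.
HB.instance Definition _ := Choice.on affW.

Lemma word_piP r1 r2 : \pi_affW r1 = \pi_affW r2 <-> word_equiv r1 r2.
Proof.
split; first by move/eqmodP/asboolP.
by move=> h; apply/eqmodP/asboolP.
Qed.

Lemma word_reprK r : word_equiv (repr (\pi_affW r)) r.
Proof. by apply/word_piP; rewrite reprK. Qed.

Lemma word_equiv_cat r1 r2 r3 r4 :
  word_equiv r1 r2 -> word_equiv r3 r4 -> word_equiv (r1 ++ r3) (r2 ++ r4).
Proof.
move=> h12 h34; apply: (@Word_trans (r2 ++ r3)).
- elim: h12 => [r|x y _|y x z _ h1 _|a b c d h].
  + exact: Word_refl.
  + exact: Word_sym.
  + exact: (Word_trans h1).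
  + by rewrite -!catA; apply: Word_step.
- elim: h34 => [r|x y _|y x z _ h1 _|a b c d h].
  + exact: Word_refl.
  + exact: Word_sym.
  + exact: (Word_trans h1).
  + by rewrite !(catA r2); apply: Word_step.
Qed.

Lemma word_equiv_rev r1 r2 : word_equiv r1 r2 -> word_equiv (rev r1) (rev r2).
Proof.
elim=> [r|x y _|y x z _ h1 _|a b c d h].
- exact: Word_refl.
- exact: Word_sym.
- exact: (Word_trans h1).
- rewrite !rev_cat -!catA; apply: Word_step.
  case: h => [i|i h|i h k1 ih]; [exact: Weyl_sq| |exact: Weyl_braid].
  by rewrite adjacent_sym => /Weyl_comm.
Qed.

Lemma word_equiv_revl r : word_equiv (rev r ++ r) [::].
Proof.
elim: r => [|i r IH]; first exact: Word_refl.
rewrite rev_cons cat_rcons; apply: Word_trans IH.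
by have := Word_step (rev r) r (Weyl_sq i).
Qed.

Definition affW_one : affW := \pi_affW [::].
Definition affW_mul (v w : affW) : affW := \pi_affW (repr v ++ repr w).
Definition affW_inv (v : affW) : affW := \pi_affW (rev (repr v)).

Lemma affW_mulE r1 r2 : affW_mul (\pi_affW r1) (\pi_affW r2) = \pi_affW (r1 ++ r2).
Proof. by apply/word_piP/word_equiv_cat; exact: word_reprK. Qed.

Lemma affW_invE r : affW_inv (\pi_affW r) = \pi_affW (rev r).
Proof. by apply/word_piP/word_equiv_rev; exact: word_reprK. Qed.

Lemma affW_ind (P : affW -> Prop) : (forall r, P (\pi_affW r)) -> forall v, P v.
Proof. by move=> h v; rewrite -(reprK v). Qed.

Lemma affW_mulA : associative affW_mul.
Proof.
elim/affW_ind=> r1; elim/affW_ind=> r2; elim/affW_ind=> r3.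
by rewrite (affW_mulE r2) (affW_mulE r1) (affW_mulE r1) (affW_mulE (r1 ++ r2)) catA.
Qed.

Lemma affW_mul1 : left_id affW_one affW_mul.
Proof. by elim/affW_ind=> r; rewrite affW_mulE. Qed.

Lemma affW_mulr1 : right_id affW_one affW_mul.
Proof. by elim/affW_ind=> r; rewrite affW_mulE cats0. Qed.

Lemma affW_mulV : left_inverse affW_one affW_inv affW_mul.
Proof.
elim/affW_ind=> r; rewrite affW_invE affW_mulE.
exact/word_piP/word_equiv_revl.
Qed.

Lemma affW_mulrV : right_inverse affW_one affW_inv affW_mul.
Proof.
elim/affW_ind=> r; rewrite affW_invE affW_mulE; apply/word_piP.
by rewrite -{1}(revK r); exact: word_equiv_revl.
Qed.

HB.instance Definition _ := isGroup.Build affW affW_mulA affW_mul1 affW_mulr1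
  affW_mulV affW_mulrV.

Definition sgen i : affW := \pi_affW [:: i].

Definition word_prod r : affW := (\prod_(i <- r) sgen i)%g.

Lemma word_prodE r : word_prod r = \pi_affW r.
Proof.
rewrite /word_prod; elim: r => [|i r IH]; first by rewrite big_nil.
by rewrite big_cons IH [LHS]affW_mulE.
Qed.

Lemma word_prod_repr (w : affW) : word_prod (repr w) = w.
Proof. by rewrite word_prodE reprK. Qed.

Lemma word_prod_cat r1 r2 :
  word_prod (r1 ++ r2) = (word_prod r1 * word_prod r2)%g.
Proof. by rewrite !word_prodE -[LHS]affW_mulE. Qed.

Lemma word_prod1 i : word_prod [:: i] = sgen i.
Proof. by rewrite word_prodE. Qed.

Definition has_word_of_size (w : affW) (n : nat) : bool :=
  `[< exists2 r, word_prod r = w & size r = n >].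

Lemma has_word w : exists n, has_word_of_size w n.
Proof.
by exists (size (repr w)); apply/asboolP; exists (repr w); rewrite ?word_prod_repr.
Qed.

Definition ell (w : affW) : nat := ex_minn (has_word w).

Definition reduced_word (w : affW) r : Prop := word_prod r = w /\ size r = ell w.

Lemma ell_word_prod r : (ell (word_prod r) <= size r)%N.
Proof.
by rewrite /ell; case: ex_minnP => n _; apply; apply/asboolP; exists r.
Qed.

Lemma has_reduced_word w : exists r, reduced_word w r.
Proof.
rewrite /reduced_word /ell; case: ex_minnP => n /asboolP[r <- <-] _.
by exists r.
Qed.

Lemma ell_mul (v w : affW) : (ell (v * w)%g <= ell v + ell w)%N.
Proof.
have [r1 [<- <-]] := has_reduced_word v; have [r2 [<- <-]] := has_reduced_word w.
by rewrite -word_prod_cat -size_cat; exact: ell_word_prod.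
Qed.

Lemma ell1 : ell 1%g = 0%N.
Proof.
apply/eqP; rewrite -leqn0 -[1%g](_ : word_prod [::] = _) ?ell_word_prod//.
by rewrite /word_prod big_nil.
Qed.

Definition bruhat_lt (v w : affW) : Prop :=
  v <> w /\
  exists rv rw, [/\ reduced_word v rv, reduced_word w rw & subseq rv rw].

Definition bruhat_cover (z w : affW) : Prop :=
  bruhat_lt z w /\ ell w = (ell z).+1.

Lemma finite_bruhat_cover w : finite_set [set z | bruhat_cover z w].
Proof.
pose W (n : nat) := [set word_prod (val t) | t in [set: n.-tuple 'I_k.+1]].
apply: (@sub_finite_set _ _ (W (ell w).-1)).
  move=> z [[_ [r [_ [[rz sz] _ _]]]] lw].
  have /eqP sr : size r = (ell w).-1 by rewrite sz lw.
  by exists (Tuple sr).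
by apply: finite_image; exact: finite_finset.
Qed.

End AffineWeyl.

Definition generated_subgroup (G : groupType) (S : set G) : set G :=
  [set x | forall H : {pred G}, group_closed H ->
     (forall y, S y -> y \in H) -> x \in H].

Definition parabolic k (j : 'I_k.+1) : set (affW k) :=
  generated_subgroup [set sgen i | i in [set i | i != j]].

Definition min_coset_rep k (j : 'I_k.+1) (w : affW k) : Prop :=
  forall v, parabolic j v -> (ell w <= ell (w * v)%g)%N.

Section Reflections.
Variables (k : nat) (V : zmodType).
Variables (a : 'I_k.+1 -> V) (f : 'I_k.+1 -> V -> int).
Hypothesis fB : forall i, {morph f i : x y / x - y}.
Hypothesis f_root2 : forall i, f i (a i) = 2.
Hypothesis f_root0 : forall i h, i != h -> ~~ adjacent i h -> f i (a h) = 0.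
Hypothesis f_rootN1 :
  forall i h, (1 < k)%N -> adjacent i h -> f i (a h) = - 1.

Let fZ i v n : f i (v *~ n) = f i v * n.
Proof.
pose F := GRing.isZmodMorphism.Build _ _ (f i) (fB i).
pose G : {additive V -> int} := HB.pack (f i) F.
by rewrite -[f i (v *~ n)]/(G _) raddfMz mulrzz.
Qed.

Definition refl (i : 'I_k.+1) (v : V) : V := v - a i *~ f i v.

Definition refl_word (r : seq 'I_k.+1) (v : V) : V := foldr refl v r.

Lemma reflect_word_cat r1 r2 v :
  refl_word (r1 ++ r2) v = refl_word r1 (refl_word r2 v).
Proof. exact: foldr_cat. Qed.

Lemma reflect_braid i h v : (1 < k)%N -> adjacent i h ->
  refl i (refl h (refl i v)) = v - a i *~ (f i v + f h v)
                                          - a h *~ (f i v + f h v).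
Proof.
move=> k1 ih; rewrite /refl !(fB, fZ) !f_root2 (f_rootN1 k1 ih).
rewrite (f_rootN1 k1) 1?adjacent_sym//.
set x := f i v; set y := f h v.
have -> : y - -1 * x = x + y by lia.
have -> : x - 2 * x - -1 * (x + y) = y by lia.
by rewrite [a i *~ (x + y)]mulrzDr opprD addrA [LHS]addrAC.
Qed.

Lemma reflect_word_equiv r1 r2 v :
  word_equiv r1 r2 -> refl_word r1 v = refl_word r2 v.
Proof.
move=> h; elim: h v => [//|x y _ IH v|y x z _ IH1 _ IH2 v|x y b c h v].
- by rewrite IH.
- by rewrite IH1 IH2.
- rewrite !reflect_word_cat; congr (refl_word x _).
  move: (refl_word y v) => {x y}v.
  case: h => [i|i h ih|i h k1 ih] /=.
  + rewrite /refl !(fB, fZ) f_root2.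
    have -> : f i v - 2 * f i v = - f i v by lia.
    by rewrite mulrNz opprK subrK.
  + have [->//|nih] := eqVneq i h.
    rewrite /refl !(fB, fZ) f_root0// f_root0 1?eq_sym// 1?adjacent_sym//.
    by rewrite !mul0r !subr0 addrAC.
  + rewrite !reflect_braid// 1?adjacent_sym//.
    by rewrite (addrC (f h v)) addrAC.
Qed.

Definition weyl_act (w : affW k) (v : V) : V := refl_word (repr w) v.

Lemma weyl_act_word r v : weyl_act (word_prod r) v = refl_word r v.
Proof. by rewrite word_prodE; exact/reflect_word_equiv/word_reprK. Qed.

Lemma weyl_act_sgen i v : weyl_act (sgen i) v = refl i v.
Proof. by rewrite -word_prod1 weyl_act_word. Qed.

Lemma weyl_actM w1 w2 v :
  weyl_act (w1 * w2)%g v = weyl_act w1 (weyl_act w2 v).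
Proof.
rewrite -(word_prod_repr w1) -(word_prod_repr w2) -word_prod_cat.
by rewrite !weyl_act_word reflect_word_cat.
Qed.

End Reflections.

(* The entries <alpha_i^vee, alpha_h> of the Cartan matrix of type A_k^(1);
   for k = 1 both summands of the adjacency part contribute, giving -2. *)
Definition cartan k (i h : 'I_k.+1) : int :=
  2 * (i == h)%:Z - (h == ordS i)%:Z - (i == ordS h)%:Z.

(* Weights are expressed in the basis (Lambda_0, ..., Lambda_k, delta) and
   coweights in the dual basis (alpha_0^vee, ..., alpha_k^vee, d); index Some i
   stands for Lambda_i, resp. alpha_i^vee, and None for delta, resp. d. *)
Section RootDatum.
Variable k : nat.
Implicit Types (i h : 'I_k.+1).

Definition weight := {ffun option 'I_k.+1 -> int}.
Definition coweight := {ffun option 'I_k.+1 -> int}.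
HB.instance Definition _ := GRing.Zmodule.on weight.
HB.instance Definition _ := GRing.Zmodule.on coweight.

Definition pairing (mu : coweight) (lam : weight) : int :=
  \sum_x mu x * lam x.

Definition fund_weight i : weight := [ffun x => (x == Some i)%:Z].

Definition simple_coroot i : coweight := [ffun x => (x == Some i)%:Z].

Definition simple_root i : weight :=
  [ffun x => if x is Some h then cartan h i else (i == ord0)%:Z].

Lemma pairingBr mu : {morph pairing mu : x y / x - y}.
Proof.
move=> x y; rewrite /pairing -sumrB; apply: eq_bigr => i _.
by rewrite !ffunE mulrBr.
Qed.

Lemma pairingBl lam : {morph pairing^~ lam : x y / x - y}.
Proof.
move=> x y; rewrite /pairing -sumrB; apply: eq_bigr => i _.
by rewrite !ffunE mulrBl.
Qed.

Lemma pairing_coroot i lam : pairing (simple_coroot i) lam = lam (Some i).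
Proof.
rewrite /pairing (bigD1 (Some i))//= ffunE eqxx mul1r big1 ?addr0// => x xi.
by rewrite ffunE (negbTE xi) mul0r.
Qed.

Lemma pairing_fund i h :
  pairing (simple_coroot i) (fund_weight h) = (i == h)%:Z.
Proof. by rewrite pairing_coroot ffunE. Qed.

Lemma pairing_root i h :
  pairing (simple_coroot i) (simple_root h) = cartan i h.
Proof. by rewrite pairing_coroot ffunE. Qed.

Lemma cartan_sym i h : cartan i h = cartan h i.
Proof. by rewrite /cartan addrAC (eq_sym i). Qed.

Hypothesis k_gt0 : (0 < k)%N.

Lemma ordS_neq i : (i == ordS i) = false.
Proof.
apply/negbTE; rewrite -val_eqE /=.
have := ltn_ord i; rewrite ltnS leq_eqVlt => /orP[/eqP->|ik].
  by rewrite modnn -lt0n.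
by rewrite modn_small// neq_ltn ltnSn.
Qed.

Lemma ordS2_neq i : (1 < k)%N -> (i == ordS (ordS i)) = false.
Proof.
move=> k1; apply/negbTE; rewrite -val_eqE /= -(addn1 (_ %% _)%N) modnDml addn1.
have ik := ltn_ord i; apply/negP=> /eqP.
have [ik2|ik2] := ltnP i.+2 k.+1; first by rewrite modn_small//; lia.
rewrite -(subnK ik2) modnDr modn_small; lia.
Qed.

Lemma cartan_diag i : cartan i i = 2.
Proof. by rewrite /cartan eqxx ordS_neq. Qed.

Lemma cartan_nonadj i h : i != h -> ~~ adjacent i h -> cartan i h = 0.
Proof. by rewrite /adjacent /cartan => /negbTE-> /norP[/negbTE-> /negbTE->]. Qed.

Lemma cartan_adj i h : (1 < k)%N -> adjacent i h -> cartan i h = - 1.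
Proof.
move=> k1 /orP[] /eqP->; rewrite /cartan eqxx.
  by rewrite ordS_neq ordS2_neq.
by rewrite eq_sym ordS_neq ordS2_neq.
Qed.

Definition weight_act : affW k -> weight -> weight :=
  weyl_act simple_root (fun i lam => pairing (simple_coroot i) lam).

Definition coweight_act : affW k -> coweight -> coweight :=
  weyl_act simple_coroot (fun i mu => pairing mu (simple_root i)).

Lemma weight_act_sgen i lam :
  weight_act (sgen i) lam =
  lam - simple_root i *~ pairing (simple_coroot i) lam.
Proof.
apply: weyl_act_sgen => [h|h|i' h|i' h]; first exact: pairingBr.
- by rewrite pairing_root cartan_diag.
- by rewrite pairing_root; exact: cartan_nonadj.
- by rewrite pairing_root; exact: cartan_adj.
Qed.

Lemma weight_actM v w lam :
  weight_act (v * w)%g lam = weight_act v (weight_act w lam).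
Proof.
apply: weyl_actM => [h|h|i h|i h]; first exact: pairingBr.
- by rewrite pairing_root cartan_diag.
- by rewrite pairing_root; exact: cartan_nonadj.
- by rewrite pairing_root; exact: cartan_adj.
Qed.

Lemma coweight_act_sgen i mu :
  coweight_act (sgen i) mu =
  mu - simple_coroot i *~ pairing mu (simple_root i).
Proof.
apply: (@weyl_act_sgen _ _ _ (fun i mu => pairing mu (simple_root i)))
  => [h|h|i' h|i' h]; first exact: pairingBl.
- by rewrite pairing_root cartan_diag.
- by rewrite pairing_root cartan_sym; exact: cartan_nonadj.
- by rewrite pairing_root cartan_sym; exact: cartan_adj.
Qed.

Lemma coweight_actM v w mu :
  coweight_act (v * w)%g mu = coweight_act v (coweight_act w mu).
Proof.
apply: (@weyl_actM _ _ _ (fun i mu => pairing mu (simple_root i)))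
  => [h|h|i h|i h]; first exact: pairingBl.
- by rewrite pairing_root cartan_diag.
- by rewrite pairing_root cartan_sym; exact: cartan_nonadj.
- by rewrite pairing_root cartan_sym; exact: cartan_adj.
Qed.

Definition nonneg_root (lam : weight) : Prop :=
  exists c : 'I_k.+1 -> nat, lam = \sum_i simple_root i *+ c i.

Definition is_cover_coroot (z w : affW k) (mu : coweight) : Prop :=
  exists u i, [/\ (z^-1 * w)%g = (u * sgen i * u^-1)%g,
    nonneg_root (weight_act u (simple_root i))
    & mu = coweight_act u (simple_coroot i)].

(* The default value 0 is only taken when z^-1 w is not a reflection. *)
Definition cover_coroot (z w : affW k) : coweight :=
  xget 0 [set mu | is_cover_coroot z w mu].

End RootDatum.

Section FreegLinear.
Variables (R : comNzRingType) (K : choiceType).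

Lemma freegZ (c b : R) (x : K) : c *: << b *g x >> = << c * b *g x >>.
Proof. by apply/eqP/freeg_eqP=> y; rewrite coeffZ !coeffU mulrA. Qed.

Lemma fglift_linear (M : lmodType R) (f : K -> M) : linear (fglift f).
Proof.
have fB := lift_is_additive f.
have f0 : fglift f 0 = 0 by rewrite -[0 in LHS](subrr 0) fB subrr.
have fN x : fglift f (- x) = - fglift f x by rewrite -sub0r fB f0 sub0r.
have fD x y : fglift f (x + y) = fglift f x + fglift f y.
  by rewrite -[y in LHS]opprK fB fN opprK.
move=> c x y; rewrite fD; congr (_ + _); elim/freeg_ind_dom0: x => [|b x D _ _ IH].
  by rewrite scaler0 f0 scaler0.
by rewrite scalerDr !fD IH freegZ !liftU scalerDr scalerA.
Qed.

HB.instance Definition _ (M : lmodType R) (f : K -> M) :=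
  GRing.isLinear.Build R {freeg K / R} M _ (fglift f) (fglift_linear f).

End FreegLinear.

(* The nilCoxeter algebra over R, as the free R-module on the basis (u_w) with
   u_v u_w = u_(vw) if the lengths add up and u_v u_w = 0 otherwise. *)
Section NilCoxeter.
Variables (R : comNzRingType) (k : nat).

Definition nilCoxeter := {freeg (affW k) / R}.
HB.instance Definition _ := GRing.Lmodule.on nilCoxeter.

Definition nilcox_basis (w : affW k) : nilCoxeter := << w >>.

Definition nilcox_gen (i : 'I_k.+1) : nilCoxeter := nilcox_basis (sgen i).

Lemma nil_basis_ind (P : nilCoxeter -> Prop) : P 0 ->
  (forall c w x, P x -> P (c *: nilcox_basis w + x)) -> forall x, P x.
Proof.
move=> P0 PS x; elim/freeg_ind_dom0: x => [//|c w x _ _]; move/(PS c w).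
by rewrite /nilcox_basis freegZ mulr1.
Qed.

Definition nil_mul_basis (v w : affW k) : nilCoxeter :=
  if ell (v * w)%g == (ell v + ell w)%N then nilcox_basis (v * w)%g else 0.

Definition nil_mul (x y : nilCoxeter) : nilCoxeter :=
  fglift (fun v => fglift (nil_mul_basis v) y) x.

Lemma nil_mul_linearl y : linear (nil_mul^~ y).
Proof. by move=> c x1 x2; rewrite /nil_mul linearP. Qed.

Lemma nil_mul_linearr x : linear (nil_mul x).
Proof.
move=> c y1 y2; rewrite /nil_mul; elim/nil_basis_ind: x => [|b w x IH].
  by rewrite !linear0 addr0.
rewrite !linearP /= IH !liftU !scale1r linearP !scalerDr !scalerA.
by rewrite (mulrC b) addrACA.
Qed.

Lemma nil_mulE v w : nil_mul (nilcox_basis v) (nilcox_basis w) = nil_mul_basis v w.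
Proof. by rewrite /nil_mul !liftU !scale1r. Qed.

Lemma nil_mul0r x : nil_mul x 0 = 0.
Proof.
apply: (addIr (nil_mul x 0)); rewrite add0r.
by have := nil_mul_linearr x 1 0 0; rewrite !scale1r addr0 => {1}<-.
Qed.

Lemma nil_mul0l x : nil_mul 0 x = 0.
Proof.
apply: (addIr (nil_mul 0 x)); rewrite add0r.
by have := nil_mul_linearl x 1 0 0; rewrite !scale1r addr0 => {1}<-.
Qed.

Lemma nil_mulDr x c y z : nil_mul x (c *: y + z) = c *: nil_mul x y + nil_mul x z.
Proof. exact: nil_mul_linearr. Qed.

Lemma nil_mulDl c x y z : nil_mul (c *: x + y) z = c *: nil_mul x z + nil_mul y z.
Proof. exact: nil_mul_linearl. Qed.

Lemma nil_mul_basisA u v w :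
  nil_mul (nilcox_basis u) (nil_mul (nilcox_basis v) (nilcox_basis w)) =
  nil_mul (nil_mul (nilcox_basis u) (nilcox_basis v)) (nilcox_basis w).
Proof.
have huv := ell_mul u v; have hvw := ell_mul v w.
have huvw := ell_mul u (v * w)%g; have huvw' := ell_mul (u * v)%g w.
have eA : (u * (v * w))%g = (u * v * w)%g := mulgA u v w.
rewrite eA in huvw; rewrite !nil_mulE /nil_mul_basis.
case: eqP => hl; case: eqP => hr; rewrite ?nil_mul0r ?nil_mul0l ?nil_mulE//.
- by rewrite /nil_mul_basis eA; case: eqP => h1; case: eqP => h2 //; lia.
- by rewrite /nil_mul_basis eA; case: eqP => h //; lia.
- by rewrite /nil_mul_basis; case: eqP => h //; lia.
Qed.

Lemma nil_mulA : associative nil_mul.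
Proof.
move=> x y z; elim/nil_basis_ind: x => [|a u x IHx]; first by rewrite !nil_mul0l.
rewrite !nil_mulDl IHx; congr (_ *: _ + _).
elim/nil_basis_ind: y {IHx} => [|b v y IHy]; first by rewrite !(nil_mul0l,nil_mul0r).
rewrite !(nil_mulDl, nil_mulDr) IHy; congr (_ *: _ + _).
elim/nil_basis_ind: z {IHy} => [|c w z IHz]; first by rewrite !nil_mul0r.
by rewrite !nil_mulDr IHz nil_mul_basisA.
Qed.

Lemma nil_mul1 : left_id (nilcox_basis 1%g) nil_mul.
Proof.
elim/nil_basis_ind=> [|c w x IH]; first by rewrite nil_mul0r.
by rewrite nil_mulDr IH nil_mulE /nil_mul_basis mul1g ell1 eqxx.
Qed.

Lemma nil_mulr1 : right_id (nilcox_basis 1%g) nil_mul.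
Proof.
elim/nil_basis_ind=> [|c w x IH]; first by rewrite nil_mul0l.
by rewrite nil_mulDl IH nil_mulE /nil_mul_basis mulg1 ell1 addn0 eqxx.
Qed.

Lemma nil_mulDlr : left_distributive nil_mul +%R.
Proof. by move=> x y z; have := nil_mulDl 1 x y z; rewrite !scale1r. Qed.

Lemma nil_mulDrr : right_distributive nil_mul +%R.
Proof. by move=> x y z; have := nil_mulDr x 1 y z; rewrite !scale1r. Qed.

Lemma nil_one_neq0 : nilcox_basis 1%g != 0.
Proof. by rewrite /nilcox_basis freegU_eq0 oner_eq0. Qed.

HB.instance Definition _ := GRing.Zmodule_isNzRing.Build nilCoxeter
  nil_mulA nil_mul1 nil_mulr1 nil_mulDlr nil_mulDrr nil_one_neq0.

Lemma nil_scaleAl (c : R) (x y : nilCoxeter) : c *: (x * y) = c *: x * y.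
Proof.
by have := nil_mulDl c x 0 y; rewrite nil_mul0l !addr0.
Qed.

Lemma nil_scaleAr (c : R) (x y : nilCoxeter) : c *: (x * y) = x * (c *: y).
Proof.
by have := nil_mulDr x c y 0; rewrite nil_mul0r !addr0.
Qed.

HB.instance Definition _ :=
  GRing.Lmodule_isLalgebra.Build R nilCoxeter nil_scaleAl.
HB.instance Definition _ :=
  GRing.Lalgebra_isAlgebra.Build R nilCoxeter nil_scaleAr.

End NilCoxeter.

Section NilCoxeterRelations.
Variables (R : comNzRingType) (k : nat).
Implicit Types (i h : 'I_k.+1).

Local Notation u := (nilcox_gen R).

Lemma word_equiv_odd (r1 r2 : seq 'I_k.+1) :
  word_equiv r1 r2 -> odd (size r1) = odd (size r2).
Proof.
elim=> [//|//|y x z _ -> _ -> //|x y b c h].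
by rewrite !size_cat !oddD; case: h.
Qed.

Lemma ell_sgen i : ell (sgen i) = 1%N.
Proof.
have := ell_word_prod [:: i]; have [[|i' r] [hr hs]] := has_reduced_word (sgen i).
  by move: hr; rewrite -word_prod1 !word_prodE => /word_piP/word_equiv_odd.
by rewrite word_prod1 -hs /=; case: (size r).
Qed.

Lemma sgenM i h : (sgen i * sgen h)%g = word_prod [:: i; h].
Proof. by rewrite -!word_prod1 -word_prod_cat. Qed.

Lemma nil_genM2 i h : u i * u h =
  if ell (word_prod [:: i; h]) == 2%N then nilcox_basis R (word_prod [:: i; h])
  else 0.
Proof. by rewrite [LHS]nil_mulE /nil_mul_basis !ell_sgen sgenM. Qed.

Lemma nil_genM3 i h l : u i * (u h * u l) =
  if ell (word_prod [:: i; h; l]) == 3%N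
  then nilcox_basis R (word_prod [:: i; h; l]) else 0.
Proof.
have e : (sgen i * word_prod [:: h; l])%g = word_prod [:: i; h; l].
  by rewrite -word_prod1 -word_prod_cat.
rewrite nil_genM2; case: eqP => h2.
  by rewrite [LHS]nil_mulE /nil_mul_basis ell_sgen h2 e.
rewrite mulr0; case: eqP => h3 //; have := ell_mul (sgen i) (word_prod [:: h; l]).
by rewrite e ell_sgen h3; have := ell_word_prod [:: h; l] => /=; lia.
Qed.

Lemma nil_gen_sq i : u i * u i = 0.
Proof.
rewrite nil_genM2 (_ : word_prod [:: i; i] = 1%g) ?ell1//.
rewrite word_prodE; apply/word_piP; exact: (Word_step [::] [::] (Weyl_sq i)).
Qed.

Lemma nil_gen_comm i h : ~~ adjacent i h -> u i * u h = u h * u i.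
Proof.
move=> ih; rewrite !nil_genM2 (_ : word_prod [:: i; h] = word_prod [:: h; i])//.
rewrite !word_prodE; apply/word_piP.
exact: (Word_step [::] [::] (Weyl_comm ih)).
Qed.

Lemma nil_gen_braid i h : (1 < k)%N -> adjacent i h ->
  u i * (u h * u i) = u h * (u i * u h).
Proof.
move=> k1 ih; rewrite !nil_genM3.
rewrite (_ : word_prod [:: i; h; i] = word_prod [:: h; i; h])//.
rewrite !word_prodE; apply/word_piP.
exact: (Word_step [::] [::] (Weyl_braid k1 ih)).
Qed.

Lemma nil_basis_word (w : affW k) (r : seq 'I_k.+1) :
  reduced_word w r -> nilcox_basis R w = \prod_(i <- r) u i.
Proof.
case=> <- {w}; elim: r => [_|i r IH]; first by rewrite /word_prod !big_nil.
have e : word_prod (i :: r) = (sgen i * word_prod r)%g.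
  by rewrite /word_prod big_cons.
have h1 := ell_mul (sgen i) (word_prod r); have h2 := ell_word_prod r.
rewrite e ell_sgen in h1 *; rewrite big_cons /= => hs.
have hr : size r = ell (word_prod r) by lia.
rewrite -IH// [RHS]nil_mulE /nil_mul_basis ell_sgen -hs hr.
by rewrite add1n eqxx.
Qed.

End NilCoxeterRelations.

Section DownOperator.
Variables (R : comNzRingType) (k : nat).

Definition down_op (Lam : weight k) : nilCoxeter R k -> nilCoxeter R k :=
  fglift (fun w : affW k =>
    \sum_(z \in [set z | bruhat_cover z w])
       (pairing (cover_coroot z w) Lam)%:~R *: nilcox_basis R z).

End DownOperator.

Record intpart := Intpart {
  intpart_seq :> seq nat;
  intpartP : sorted geq intpart_seq && (0 \notin intpart_seq)%N
}.

Section Partitions.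
Implicit Types (lam mu : intpart) (c d : nat * nat) (f g : nat -> nat).

Definition part_row lam (a : nat) : nat := nth 0%N lam a.

Lemma row_anti lam a b : (a <= b)%N -> (part_row lam b <= part_row lam a)%N.
Proof.
move=> ab; rewrite /part_row; have /andP[ss _] := intpartP lam.
have [bs|sb] := ltnP b (size lam); last by rewrite (nth_default _ sb).
move: ab; rewrite leq_eqVlt => /orP[/eqP e|ab]; first by rewrite e.
have geqT : transitive geq by move=> x y z yx xz; exact: leq_trans xz yx.
by apply: (sorted_ltn_nth geqT 0%N ss) => //; rewrite inE// (ltn_trans ab).
Qed.

Lemma row_default lam a : (size lam <= a)%N -> part_row lam a = 0%N.
Proof. exact: nth_default. Qed.

Lemma sumn_row lam N : (size lam <= N)%N -> sumn lam = (\sum_(0 <= a < N) part_row lam a)%N.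
Proof.
move=> sN; rewrite (big_cat_nat (leq0n _) sN) /=.
rewrite [X in (_ + X)%N]big_nat [X in (_ + X)%N]big1 ?addn0; last first.
  by move=> a /andP[sa _]; exact: row_default.
by rewrite sumnE (big_nth 0%N).
Qed.

Lemma empty_partitionP : sorted geq [::] && (0 \notin [::])%N.
Proof. by []. Qed.

Definition empty_partition : intpart := Intpart empty_partitionP.

Definition seq_of_rows f (N : nat) : seq nat := [seq x <- mkseq f N | x != 0%N].

Lemma seq_of_rowsP f N : (forall a, f a.+1 <= f a)%N ->
  sorted geq (seq_of_rows f N) && (0 \notin seq_of_rows f N)%N.
Proof.
move=> fS; rewrite mem_filter eqxx /= andbT.
apply: sorted_filter; first by move=> x y z yx xz; exact: leq_trans xz yx.
apply/(sortedP 0%N) => i; rewrite size_mkseq => iN; rewrite !nth_mkseq ?(ltnW iN)//; exact: fS.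
Qed.

Lemma nth_seq_of_rows f N a : (forall a, f a.+1 <= f a)%N -> f N = 0%N ->
  nth 0%N (seq_of_rows f N) a = f a.
Proof.
move=> fS fN; have fA b b' : (b <= b')%N -> (f b' <= f b)%N.
  by move/subnK<-; elim: (b' - b)%N => [//|m IH]; exact: leq_trans (fS _) IH.
rewrite /seq_of_rows; have [m [mN fm fm0]] : exists m, [/\ (m <= N)%N, f m = 0%N &
    forall b, (b < m)%N -> f b != 0%N].
  have ex : exists m, f m == 0%N by exists N; rewrite fN.
  exists (ex_minn ex); case: ex_minnP => m /eqP fm mmin; split=> //.
    by apply: mmin; rewrite fN.
  by move=> b; apply: contraTneq => /eqP/mmin; rewrite leqNgt.
have -> : [seq x <- mkseq f N | x != 0%N] = mkseq f m.
  rewrite -(subnKC mN) /mkseq iotaD map_cat filter_cat.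
  rewrite (_ : [seq _ <- map f (iota 0 m) | _] = map f (iota 0 m)); last first.
    apply/all_filterP/allP => x /mapP[b]; rewrite mem_iota => /andP[_ bm] ->.
    exact: fm0.
  rewrite (_ : [seq _ <- _ | _] = [::]) ?cats0//.
  apply/eqP; rewrite -(negbK (_ == _)) -has_filter -all_predC.
  apply/allP => x /mapP[b]; rewrite mem_iota => /andP[mb _] -> /=.
  by rewrite negbK -leqn0 -fm; exact: fA.
have [am|ma] := ltnP a m; first by rewrite nth_mkseq.
by rewrite nth_default ?size_mkseq//; apply/esym/eqP; rewrite -leqn0 -fm fA.
Qed.

(* Cells are pairs (row, column), both counted from 0. *)
Definition in_diagram lam c : bool := (c.2 < part_row lam c.1)%N.

Definition addable lam c : bool :=
  (c.2 == part_row lam c.1) && ((c.1 == 0) || (c.2 < part_row lam c.1.-1))%N.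

Definition removable lam c : bool :=
  (c.2.+1 == part_row lam c.1) && (part_row lam c.1.+1 <= c.2)%N.

Definition cell_adj c d : Prop :=
  (c.1 = d.1 /\ (c.2 = d.2.+1 \/ d.2 = c.2.+1)) \/
  (c.2 = d.2 /\ (c.1 = d.1.+1 \/ d.1 = c.1.+1)).

Definition in_skew lam mu c : bool := in_diagram lam c && ~~ in_diagram mu c.

Definition skew_connected lam mu : Prop :=
  forall c d, in_skew lam mu c -> in_skew lam mu d ->
  clos_refl_trans _
    (fun c d => [/\ in_skew lam mu c, in_skew lam mu d & cell_adj c d]) c d.

Definition rim_hook (n : nat) lam mu : Prop :=
  [/\ forall c, in_diagram mu c -> in_diagram lam c,
      sumn lam = (sumn mu + n)%N,
      skew_connected lam mu
    & forall a b, ~ [/\ in_skew lam mu (a, b), in_skew lam mu (a.+1, b),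
                        in_skew lam mu (a, b.+1) & in_skew lam mu (a.+1, b.+1)]].

Definition is_core (n : nat) lam : Prop := forall mu, ~ rim_hook n lam mu.

Lemma in_skewE lam mu c :
  in_skew lam mu c = (part_row mu c.1 <= c.2 < part_row lam c.1)%N.
Proof. by rewrite /in_skew /in_diagram -leqNgt andbC. Qed.

(* A rim hook of length n can be removed iff some beta-number part_row lam a - a can
   be lowered by n to a value which is not a beta-number. *)
Definition bead_gap (n : nat) f : Prop := exists p q,
  (f p + q < f q + p + n)%N /\ (f q.+1 + p + n < f p + q + 1)%N.

Definition flush (n : nat) f : Prop :=
  forall p, exists q, (f q + p + n = f p + q)%N.

Lemma telescope f g p q : (p <= q)%N ->
  (forall a, (a < p)%N -> f a = g a) ->
  (forall a, (p <= a < q)%N -> f a.+1 = (g a).+1) ->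
  (\sum_(0 <= a < q.+1) f a + g q + p = \sum_(0 <= a < q.+1) g a + f p + q)%N.
Proof.
move=> pq fgp fgpq; rewrite -(subnKC pq) in fgpq *.
elim: (q - p)%N fgpq => [|m IH] fgpq.
  rewrite addn0 !big_nat_recr//= [X in (X + _ + _ + _ = _)%N](eq_big_nat _ _ (F2 := g)).
    by lia.
  by move=> a /andP[_ /fgp].
rewrite addnS !(big_nat_recr (p + m).+1)//=.
have := IH (fun a h => fgpq a ltac:(lia)).
have := fgpq (p + m)%N ltac:(lia); lia.
Qed.

Lemma rim_hook_gap n lam mu : (0 < n)%N -> rim_hook n lam mu -> bead_gap n (part_row lam).
Proof.
move=> n0 [sub sz conn no22]; set f := part_row lam; set g := part_row mu.
have gf a : (g a <= f a)%N.
  rewrite leqNgt; apply/negP => fg.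
  by have := sub (a, f a) fg; rewrite /in_diagram /= ltnn.
have fA := row_anti lam; have gA := row_anti mu.
rewrite -/f -/g in fA gA.
pose N := (size lam + size mu)%N.
have sz' : (\sum_(0 <= a < N) f a = \sum_(0 <= a < N) g a + n)%N.
  by rewrite -!sumn_row// ?leq_addr ?leq_addl.
have exS : exists a, (g a < f a)%N.
  apply: contrapT => nex; have fg a : f a = g a.
    apply/eqP; rewrite eqn_leq gf andbT leqNgt; apply/negP => h.
    by apply: nex; exists a.
  by move: sz'; rewrite (eq_bigr g)//; lia.
have SN a : (g a < f a)%N -> (a <= N)%N.
  move=> h; rewrite leqNgt; apply/negP => aN; move: h.
  by rewrite /f row_default//; move: aN; rewrite /N; lia.
case: (ex_minnP exS) => p Sp pmin; case: (ex_maxnP exS SN) => q Sq qmax.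
have pq := pmin _ Sq.
have cross r c d : clos_refl_trans _
    (fun c d => [/\ in_skew lam mu c, in_skew lam mu d & cell_adj c d]) c d ->
    (forall b, (g r <= b)%N -> ~~ (b < f r.+1)%N) -> (c.1 <= r)%N -> (d.1 <= r)%N.
  move=> cd nb; elim: cd => [[a1 b1] [a2 b2]|//|x y z _ IH1 _ IH2 /IH1/IH2//].
  rewrite !in_skewE /= -/f -/g => -[h1 h2 h3] a1r; rewrite leqNgt; apply/negP => ra2.
  have [ea1 ea2 eb] : [/\ a1 = r, a2 = r.+1 & b1 = b2].
    by case: h3 => /= -[] e1 [] e2; split; lia.
  move: h1 h2; rewrite ea1 ea2 eb => /andP[/nb/negP h _] /andP[_ ?]; exact: h.
have mid a : (p <= a < q)%N -> f a.+1 = (g a).+1.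
  move=> /andP[pa aq]; apply/eqP; rewrite eqn_leq; apply/andP; split.
    rewrite leqNgt; apply/negP => h; apply: (no22 a (g a)).
    have h1 := fA a a.+1 (leqnSn _); have h2 := gA a a.+1 (leqnSn _).
    by rewrite !in_skewE /= -/f -/g; split; lia.
  rewrite ltnNge; apply/negP => h.
  have /(cross a) : clos_refl_trans _
      (fun c d => [/\ in_skew lam mu c, in_skew lam mu d & cell_adj c d])
      (p, g p) (q, g q).
    by apply: conn; rewrite in_skewE /= leqnn.
  move=> /(_ _ pa) /=; rewrite leqNgt aq => /(_ _)/negP; apply=> //.
  by move=> b gb; rewrite -leqNgt (leq_trans h).
have eqlo a : (a < p)%N -> f a = g a.
  move=> ap; apply/eqP; rewrite eqn_leq gf andbT leqNgt; apply/negP => /pmin.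
  by rewrite leqNgt ap.
have eqhi a : (q < a)%N -> f a = g a.
  move=> ap; apply/eqP; rewrite eqn_leq gf andbT leqNgt; apply/negP => /qmax.
  by rewrite leqNgt ap.
have qN : (q < N)%N.
  rewrite ltnNge; apply/negP => Nq; move: Sq.
  by rewrite {1}/f row_default//; move: Nq; rewrite /N; lia.
have := telescope pq eqlo mid.
move: sz'; rewrite !(big_cat_nat (leq0n q.+1) qN)/=.
rewrite [X in (_ + X = _)%N](eq_big_nat _ _ (F2 := g)); last first.
  by move=> a /andP[qa _]; exact: eqhi.
have := eqhi q.+1 (ltnSn q); have := gA q q.+1 (leqnSn _).
by move=> h1 h2 h3 h4; exists p, q; rewrite -/f; split; lia.
Qed.

Lemma gap_rim_hook n lam : (0 < n)%N -> bead_gap n (part_row lam) ->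
  exists mu, rim_hook n lam mu.
Proof.
move=> n0 [p [q [h1 h2]]]; set f := part_row lam in h1 h2 *.
have fA := row_anti lam; rewrite -/f in fA.
have pq : (p <= q)%N.
  rewrite leqNgt; apply/negP => qp; have := fA q.+1 p qp; lia.
pose g r := if (r < p)%N then f r else if (r < q)%N then (f r.+1).-1
            else if r == q then (f p + q - p - n)%N else f r.
have fq0 : (0 < f q)%N by lia.
have fpos r : (r <= q)%N -> (0 < f r)%N by move=> rq; have := fA r q rq; lia.
have glo r : (r < p)%N -> g r = f r by rewrite /g => ->.
have gmid r : (p <= r < q)%N -> f r.+1 = (g r).+1.
  move=> /andP[pr rq]; rewrite /g ltnNge pr rq /= prednK//; exact: fpos.
have gq : g q = (f p + q - p - n)%N by rewrite /g ltnNge pq ltnn eqxx.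
have ghi r : (q < r)%N -> g r = f r.
  move=> qr; rewrite /g; have -> : (r < p)%N = false by lia.
  have -> : (r < q)%N = false by lia.
  by have -> : (r == q) = false by lia.
have gf r : (g r <= f r)%N.
  have [rp|pr] := ltnP r p; first by rewrite glo.
  have [rq|qr] := ltnP r q.
    by have := gmid r; have := fA r r.+1 (leqnSn r); rewrite pr rq => + /(_ isT); lia.
  have [e|rq] := eqVneq r q; first by rewrite e gq; lia.
  by rewrite ghi//; lia.
have gS r : (g r.+1 <= g r)%N.
  have fS := fA r r.+1 (leqnSn r); have fSS := fA r.+1 r.+2 (leqnSn _).
  have [rp|pr] := ltnP r p; first by rewrite (glo r)// (leq_trans (gf _)).
  have [rq|qr] := ltnP r q; last first.
    have [e|rq] := eqVneq r q; first by rewrite ghi ?e// gq; lia.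
    by rewrite !ghi//; lia.
  have e1 := gmid r ltac:(lia).
  have [rq1|qr1] := ltnP r.+1 q; first by have := gmid r.+1 ltac:(lia); lia.
  have e : r.+1 = q by lia.
  by rewrite -e in h1 gq; rewrite gq; lia.
pose N := (size lam + q).+1.
have fN : f N = 0%N by apply: row_default; rewrite /N; lia.
have gN : g N = 0%N by rewrite ghi// /N; lia.
pose mu := Intpart (seq_of_rowsP N gS).
have muE a : part_row mu a = g a by exact: nth_seq_of_rows.
have skE c : in_skew lam mu c = (g c.1 <= c.2 < f c.1)%N.
  by rewrite in_skewE muE.
exists mu; split.
- by move=> c; rewrite /in_diagram muE => h; exact: leq_trans h (gf _).
- have sN : (size mu <= N)%N.
    by rewrite /= /seq_of_rows size_filter (leq_trans (count_size _ _))// size_mkseq.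
  rewrite (sumn_row sN) (@sumn_row lam N); last by rewrite /N; lia.
  have qN : (q < N)%N by rewrite /N; lia.
  have := telescope pq (fun a ap => esym (glo a ap)) gmid.
  rewrite (eq_big_nat _ _ (F1 := part_row mu) (F2 := g)); last by move=> a _; exact: muE.
  rewrite !(big_cat_nat (leq0n q.+1) qN)/= -/f.
  rewrite [(\sum_(q.+1 <= a < N) f a)%N](eq_big_nat _ _ (F2 := g)).
    by rewrite gq; lia.
  by move=> a /andP[qa _]; rewrite ghi.
- move=> c d; pose T := clos_refl_trans _
    (fun c d => [/\ in_skew lam mu c, in_skew lam mu d & cell_adj c d]).
  have Tsym x y : T x y -> T y x.
    elim=> [{}x {}y [sx sy a]|{}x|{}x {}y z _ yx _ zy]; last exact: rt_trans yx.
      apply: rt_step; split=> //; move: a; rewrite /cell_adj.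
      by case=> -[-> [] ->]; [left|left|right|right]; split=> //; [right|left|right|left].
    exact: rt_refl.
  have hor r m : (g r + m < f r)%N -> T (r, (g r + m)%N) (r, g r).
    elim: m => [|m IH] h; first by rewrite addn0; exact: rt_refl.
    apply: rt_trans (IH _); last by lia.
    apply: rt_step; rewrite !skE /=; split; [lia|lia|].
    by left; split=> //; left; rewrite addnS.
  have ver m r : (p <= r)%N -> (r + m = q)%N -> T (r, g r) (q, g q).
    elim: m r => [|m IH] r pr rq; first by rewrite -rq addn0; exact: rt_refl.
    apply: rt_trans (IH r.+1 _ _); [|lia|lia].
    have e := gmid r ltac:(lia).
    have fr := fA r r.+1 (leqnSn _).
    have gf1 := gf r.+1; have gS1 := gS r.
    have ltr : (g r.+1 < f r.+1)%N.
      have [rq1|qr1] := ltnP r.+1 q; first by have := gmid r.+1 ltac:(lia); have := fA r.+1 r.+2 (leqnSn _); lia.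
      have e1 : r.+1 = q by lia.
      by rewrite e1 gq; lia.
    apply: (@rt_trans _ _ _ (r.+1, g r)).
      apply: rt_step; rewrite !skE /=; split; [lia|lia|].
      by right; split=> //; right.
    have -> : g r = (g r.+1 + (g r - g r.+1))%N by lia.
    by apply: hor; lia.
  have base c0 : in_skew lam mu c0 -> T c0 (q, g q).
    case: c0 => r b; rewrite skE /= => /andP[gb bf].
    have pr : (p <= r)%N.
      by rewrite leqNgt; apply/negP => /glo e; lia.
    have rq : (r <= q)%N.
      by rewrite leqNgt; apply/negP => /ghi e; lia.
    apply: (@rt_trans _ _ _ (r, g r)); last by apply: (ver (q - r)%N) => //; lia.
    by have -> : b = (g r + (b - g r))%N by [lia]; apply: hor; lia.
  by move=> /base cT /base /Tsym; exact: rt_trans.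
- move=> a b; rewrite !skE /= => -[c1 _ _ c4].
  have pa : (p <= a)%N by rewrite leqNgt; apply/negP => /glo e; lia.
  have aq : (a.+1 <= q)%N by rewrite leqNgt; apply/negP => /ghi e; lia.
  by have := gmid a ltac:(lia); lia.
Qed.

Lemma flush_no_gap n f : (forall a b, (a <= b)%N -> (f b <= f a)%N) ->
  flush n f -> ~ bead_gap n f.
Proof.
move=> fA fl [p [q [h1 h2]]]; have [r hr] := fl p.
have [rq|qr] := leqP r q; first by have := fA r q rq; lia.
by have := fA q.+1 r qr; lia.
Qed.

Lemma no_gap_flush n f N : (0 < n)%N -> (forall a b, (a <= b)%N -> (f b <= f a)%N) ->
  f N = 0%N -> ~ bead_gap n f -> flush n f.
Proof.
move=> n0 fA fN ng p.
have ex : exists q, (f q + p + n <= f p + q)%N.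
  by exists (N + p + n)%N; have := fA N (N + p + n)%N ltac:(lia); lia.
case: (ex_minnP ex) => q hq qmin; exists q; apply/eqP; rewrite eqn_leq hq /=.
rewrite leqNgt; apply/negP => lt; case: q hq qmin lt => [|q] hq qmin lt.
  by have := fA 0%N p (leq0n p); lia.
apply: ng; exists p, q; split; last by lia.
by rewrite ltnNge; apply/negP => /qmin; rewrite ltnn.
Qed.

Lemma flushP n lam : (0 < n)%N -> is_core n lam <-> flush n (part_row lam).
Proof.
move=> n0; split=> [h|h mu /(rim_hook_gap n0)].
  apply: (@no_gap_flush _ _ (size lam)) => //; first exact: row_anti.
    exact: row_default.
  by move=> /(gap_rim_hook n0)[mu]; exact: h.
by apply: flush_no_gap => //; exact: row_anti.
Qed.

End Partitions.

Section CoreAction.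
Variable k : nat.
Implicit Types (lam : intpart) (c : nat * nat) (i : 'I_k.+1).

Definition residue c : 'I_k.+1 := inZp c.2 - inZp c.1.

Definition addable_cells i lam : seq (nat * nat) :=
  [seq c <- [seq (a, part_row lam a) | a <- iota 0 (size lam).+1]
     | addable lam c && (residue c == i)].

Definition removable_cells i lam : seq (nat * nat) :=
  [seq c <- [seq (a, (part_row lam a).-1) | a <- iota 0 (size lam)]
     | removable lam c && (residue c == i)].

Lemma mem_addable_cells i lam c :
  (c \in addable_cells i lam) = addable lam c && (residue c == i).
Proof.
rewrite mem_filter andb_idr// => /andP[]; case: c => a b.
move=> /andP[/= /eqP-> h] _.
apply: (@map_f _ _ (fun a => (a, part_row lam a)) (iota 0 (size lam).+1)).
rewrite mem_iota leq0n add0n ltnS; have [//|sa] := leqP a (size lam).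
by move: h; rewrite (row_default (a := a.-1)) ?ltn0 ?orbF; lia.
Qed.

Lemma mem_removable_cells i lam c :
  (c \in removable_cells i lam) = removable lam c && (residue c == i).
Proof.
rewrite mem_filter andb_idr// => /andP[]; case: c => a b.
move=> /andP[/= /eqP h _] _.
have -> : b = (part_row lam a).-1 by rewrite -h.
apply: (@map_f _ _ (fun a => (a, (part_row lam a).-1)) (iota 0 (size lam))).
by rewrite mem_iota leq0n add0n ltnNge; apply/negP => /row_default; lia.
Qed.

Lemma addable_cells_uniq i lam : uniq (addable_cells i lam).
Proof.
rewrite filter_uniq// map_inj_uniq ?iota_uniq// => a b; by case.
Qed.

Definition add_row i lam a : nat :=
  (part_row lam a + ((a, part_row lam a) \in addable_cells i lam))%N.

Definition remove_row i lam a : nat :=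
  (part_row lam a - ((a, (part_row lam a).-1) \in removable_cells i lam))%N.

Lemma add_row_anti i lam a : (add_row i lam a.+1 <= add_row i lam a)%N.
Proof.
rewrite /add_row mem_addable_cells /addable /= eqxx /=.
by have := row_anti lam (leqnSn a); case: ltnP; lia.
Qed.

Lemma remove_row_anti i lam a : (remove_row i lam a.+1 <= remove_row i lam a)%N.
Proof.
rewrite /remove_row !mem_removable_cells /removable /=.
have := row_anti lam (leqnSn a); case: (leqP (part_row lam a.+1)) => /=; lia.
Qed.

Definition add_cells i lam : intpart :=
  Intpart (seq_of_rowsP (size lam).+1 (add_row_anti i lam)).

Definition remove_cells i lam : intpart :=
  Intpart (seq_of_rowsP (size lam).+1 (remove_row_anti i lam)).

Lemma row_add_cells i lam a : part_row (add_cells i lam) a = add_row i lam a.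
Proof.
apply: nth_seq_of_rows; first exact: add_row_anti.
by rewrite /add_row mem_addable_cells /addable /= !row_default.
Qed.

Lemma row_remove_cells i lam a : part_row (remove_cells i lam) a = remove_row i lam a.
Proof.
apply: nth_seq_of_rows; first exact: remove_row_anti.
by rewrite /remove_row row_default.
Qed.

Lemma in_add_cells i lam c :
  in_diagram (add_cells i lam) c = in_diagram lam c || (c \in addable_cells i lam).
Proof.
rewrite /in_diagram row_add_cells /add_row; case: c => a b /=.
have [e|ne] := eqVneq b (part_row lam a).
  by rewrite e ltnn /=; case: (_ \in _); rewrite ?addn1 ?addn0 ?ltnSn ?ltnn.
rewrite [_ \in _ in RHS]mem_addable_cells /addable /= (negbTE ne) orbF.
by case: (_ \in _) => /=; lia.
Qed.

Lemma in_remove_cells i lam c :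
  in_diagram (remove_cells i lam) c =
  in_diagram lam c && (c \notin removable_cells i lam).
Proof.
rewrite /in_diagram row_remove_cells /remove_row; case: c => a b /=.
have [e|ne] := eqVneq b.+1 (part_row lam a).
  by rewrite -e /=; case: (_ \in _) => /=; lia.
rewrite [_ \in _ in RHS]mem_removable_cells /removable /= (negbTE ne) andbT.
rewrite mem_removable_cells /removable /=.
by case: (_ && _) => /=; lia.
Qed.

Definition intpart_act i lam : intpart :=
  if addable_cells i lam != [::] then add_cells i lam
  else if removable_cells i lam != [::] then remove_cells i lam
  else lam.

Lemma eq_residue a b a' b' :
  residue (a, b) = residue (a', b') <-> (b + a' = b' + a %[mod k.+1])%N.
Proof.
have inZpD x y : inZp (x + y) = inZp x + inZp y :> 'I_k.+1.
  by apply: val_inj; rewrite /= modnDm.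
have -> : residue (a, b) = residue (a', b') <->
          inZp (b + a') = inZp (b' + a) :> 'I_k.+1.
  rewrite !inZpD /residue /=; split=> [/eqP|/eqP].
    by rewrite subr_eq addrAC -subr_eq opprK => /eqP.
  by move=> /eqP h; apply/eqP; rewrite subr_eq addrAC -subr_eq opprK h.
by split=> [/(congr1 val)|h]; last exact: val_inj.
Qed.

Lemma residue_shift a b : (0 < k)%N -> residue (a, b) <> residue (a.+1, b).
Proof.
move=> k0 /eq_residue/eqP; rewrite eqn_modDl -addn1 -{2}(addn0 a) eqn_modDl.
by rewrite !modn_small.
Qed.

Lemma residue_bead a b a' b' : (b' + a + k.+1 = b + a')%N ->
  residue (a, b) = residue (a', b').
Proof. by move=> h; apply/eq_residue; rewrite -h modnDr. Qed.

Lemma flush_add_row i lam : (0 < k)%N ->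
  flush k.+1 (part_row lam) -> flush k.+1 (add_row i lam).
Proof.
move=> k0 fl p; set f := part_row lam in fl *.
have fA := row_anti lam; rewrite -/f in fA.
have aE a : add_row i lam a = (f a + (((a == 0%N) || (f a < f a.-1)) &&
    (residue (a, f a) == i)))%N.
  by rewrite /add_row mem_addable_cells /addable /= eqxx.
have [q hq] := fl p; have res := residue_bead hq.
have pq : (p < q)%N by rewrite ltnNge; apply/negP => qp; have := fA _ _ qp; lia.
case: q pq hq res => // q pq hq res.
have fq := fA q q.+1 (leqnSn q).
case: (eqVneq (residue (p, f p)) i) => [ri|nri]; last first.
  by exists q.+1; rewrite !aE -res (negbTE nri) !andbF !addn0.
have aq : add_row i lam q.+1 = (f q.+1 + (f q.+1 < f q))%N.
  by rewrite aE /= -res ri eqxx andbT.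
have ap : add_row i lam p = (f p + ((p == 0%N) || (f p < f p.-1)))%N.
  by rewrite aE ri eqxx andbT.
have [lt|ge] := ltnP (f q.+1) (f q).
  suff addp : (p == 0%N) || (f p < f p.-1)%N.
    by exists q.+1; rewrite aq ap addp lt; lia.
  case: p hq pq {res ri aq ap} => // p hq pq; rewrite /= ltnNge; apply/negP => fpp.
  have epp : f p = f p.+1 by have := fA p p.+1 (leqnSn p); lia.
  have [r hr] := fl p.
  have [rq|qr] := leqP r q; first by have := fA r q rq; lia.
  by have := fA q.+1 r qr; lia.
have e : f q = f q.+1 by lia.
have [addp|nadd] := boolP ((p == 0%N) || (f p < f p.-1)%N); last first.
  by exists q.+1; rewrite aq ap (negbTE nadd) ltnNge ge /=; lia.
exists q; rewrite ap addp aE.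
have -> : (residue (q, f q) == i) = false.
  by apply/negP => /eqP; rewrite -ri res e; exact: residue_shift.
by rewrite andbF; lia.
Qed.

Lemma flush_remove_row i lam : (0 < k)%N ->
  flush k.+1 (part_row lam) -> flush k.+1 (remove_row i lam).
Proof.
move=> k0 fl p; set f := part_row lam in fl *.
have fA := row_anti lam; rewrite -/f in fA.
have rE a : remove_row i lam a = (f a - ((f a.+1 < f a) &&
    (residue (a, (f a).-1) == i)))%N.
  rewrite /remove_row mem_removable_cells /removable /= -/f.
  congr (_ - (_ && _ : bool))%N.
  by case: (f a) => [|x] /=; rewrite ?ltn0 ?eqxx//.
have [q hq] := fl p.
have pq : (p < q)%N by rewrite ltnNge; apply/negP => qp; have := fA _ _ qp; lia.
have fp := fA p p.+1 (leqnSn p); have fq := fA q q.+1 (leqnSn q).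
have fpq := fA p q (ltnW pq).
have [fq0|fq0] := posnP (f q).
  have [rp|nrp] := boolP ((f p.+1 < f p)%N && (residue (p, (f p).-1) == i)); last first.
    by exists q; rewrite !rE (negbTE nrp) fq0; lia.
  by exists q.+1; rewrite !rE rp; have := fA q.+1 q.+2 (leqnSn _); lia.
have res : residue (p, (f p).-1) = residue (q, (f q).-1).
  by apply: residue_bead; lia.
case: (eqVneq (residue (p, (f p).-1)) i) => [ri|nri]; last first.
  by exists q; rewrite !rE -res (negbTE nri) !andbF !subn0.
have rq : remove_row i lam q = (f q - (f q.+1 < f q))%N.
  by rewrite rE -res ri eqxx andbT.
have rp : remove_row i lam p = (f p - (f p.+1 < f p))%N.
  by rewrite rE ri eqxx andbT.
have [lt|ge] := ltnP (f q.+1) (f q).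
  suff remp : (f p.+1 < f p)%N by exists q; rewrite rq rp remp lt; lia.
  rewrite ltnNge; apply/negP => fpp.
  have [r hr] := fl p.+1.
  have [rlq|qr] := leqP r q; first by have := fA r q rlq; lia.
  by have := fA q.+1 r qr; lia.
have e : f q.+1 = f q by lia.
have [remp|nrem] := ltnP (f p.+1) (f p); last first.
  by exists q; rewrite rq rp !ltnNge nrem ge /=; lia.
exists q.+1; rewrite rp remp rE.
have -> : (residue (q.+1, (f q.+1).-1) == i) = false.
  by apply/negP => /eqP; rewrite -ri res e => /esym; exact: residue_shift.
by rewrite andbF; lia.
Qed.

Lemma intpart_act_core i lam : (0 < k)%N ->
  is_core k.+1 lam -> is_core k.+1 (intpart_act i lam).
Proof.
move=> k0 /flushP-/(_ isT) fl; rewrite /intpart_act.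
case: ifP => _; last (case: ifP => _; last exact/flushP); apply/flushP => //.
  move=> p; have [q hq] := flush_add_row i k0 fl p.
  by exists q; rewrite !row_add_cells.
move=> p; have [q hq] := flush_remove_row i k0 fl p.
by exists q; rewrite !row_remove_cells.
Qed.

Lemma empty_core : is_core k.+1 empty_partition.
Proof. by move=> mu [_ /= + _ _]; lia. Qed.

Definition kcore : Type := {lam : intpart | is_core k.+1 lam}.

Definition kcore0 : kcore := exist _ empty_partition empty_core.

Definition kcore_act (k_gt0 : (0 < k)%N) i (lam : kcore) : kcore :=
  exist _ (intpart_act i (sval lam)) (@intpart_act_core i _ k_gt0 (svalP lam)).

End CoreAction.

Section Coefficients.
Variable k : nat.
Hypothesis k_gt0 : (0 < k)%N.

(* kcore_word [:: i_l; ...; i_1] is s_(i_l) ... s_(i_1) applied to the empty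
   core. *)
Definition kcore_word (r : seq 'I_k.+1) : kcore k :=
  foldr (kcore_act k_gt0) (kcore0 k) r.

(* The word r1 ++ i :: r2 is i_m ... i_1 with i = i_l, so that r2 is
   i_(l-1) ... i_1. *)
Definition is_down_coef (w : affW k) (j : 'I_k.+1) (z : affW k) (n : nat) :
    Prop :=
  exists r1 i r2,
    [/\ reduced_word w (r1 ++ i :: r2), reduced_word z (r1 ++ r2)
      & n = size (addable_cells (i - j) (sval (kcore_word [seq h - j | h <- r2])))].

End Coefficients.

(* Main.v *)
(** If [w = a s_i b] is reduced and [z = a b], then [z^-1 w] is the reflection in
   the root [b^-1 alpha_i], which is positive because [s_i b] is reduced. So the
   coefficient of [u_z] is [<alpha_i^vee, b Lambda_j>]. For a core [lam] let
   [charge lam i] be the number of addable minus the number of removable cells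
   of residue [i]. Under [s_i], the charges of a core change exactly like the
   fundamental coordinates of a weight, so the coefficient is the charge of the
   core [b 0] at [i - j]. A core has no addable and removable cell of
   the same residue, and the charge is nonnegative since the root is positive:
   hence there is no removable cell and the charge counts the addable ones. *)

From HB Require Import structures.
Require Import Defs.
From mathcomp Require Import all_boot all_order all_algebra.
From mathcomp Require Import boolp classical_sets cardinality fsbigop.
From mathcomp Require Import freeg zify.

Set Implicit Arguments.
Unset Strict Implicit.
Unset Printing Implicit Defensive.

Import Order.TTheory GRing.Theory Num.Theory.

Local Open Scope classical_set_scope.
Local Open Scope ring_scope.

Lemma subr_mulrzN (V : zmodType) (x y : V) n : x - y *~ (- Posz n) = x + y *+ n.
Proof. by rewrite mulrNz opprK. Qed.

(** For adjacent s, t and [k > 1] this is s_s s_t(alpha_s) = alpha_t, with [x], [y] the images of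
    alpha_s, alpha_t. *)
Lemma reflectK (V : zmodType) (x y : V) : x - x *~ 2 - (y - x *~ - 1) *~ - 1 = y.
Proof.
rewrite -[x *~ 2]/(x *+ 2) mulr2n !mulrNz !mulr1z !opprK (addrC y) addrA.
by rewrite opprD addrA subrr sub0r addNr add0r.
Qed.

(** * Words, length and parity in the affine symmetric group *)

Section Length.
Variable k : nat.
Implicit Types (w : affW k) (i h : 'I_k.+1) (r : seq 'I_k.+1).

Lemma word_prod_nil : word_prod [::] = 1%g :> affW k.
Proof. by rewrite /word_prod big_nil. Qed.

Lemma word_prod_cons i r : word_prod (i :: r) = (sgen i * word_prod r)%g.
Proof. by rewrite /word_prod big_cons. Qed.

Lemma word_prod_rel a b : weyl_relation a b -> word_prod a = word_prod b :> affW k.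
Proof.
move=> ab; rewrite !word_prodE; apply/word_piP.
by have := Word_step [::] [::] ab; rewrite !cats0.
Qed.

Lemma sgen_sq i : (sgen i * sgen i)%g = 1%g.
Proof. by rewrite sgenM -word_prod_nil; exact/word_prod_rel/Weyl_sq. Qed.

Lemma sgenV i : ((sgen i)^-1)%g = sgen i.
Proof. by rewrite -[RHS]mul1g -(mulVg (sgen i)) -mulgA sgen_sq mulg1. Qed.

Lemma sgenK w i : (w * sgen i * sgen i)%g = w.
Proof. by rewrite -mulgA sgen_sq mulg1. Qed.

Lemma sgen_comm i h : ~~ adjacent i h -> (sgen i * sgen h)%g = (sgen h * sgen i)%g.
Proof. by move=> ih; rewrite !sgenM; exact/word_prod_rel/Weyl_comm. Qed.

Lemma sgen_braid i h : (1 < k)%N -> adjacent i h ->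
  (sgen i * sgen h * sgen i)%g = (sgen h * sgen i * sgen h)%g.
Proof.
move=> k1 ih; rewrite !sgenM -!word_prod1 -!word_prod_cat.
exact/word_prod_rel/Weyl_braid.
Qed.

Lemma odd_ell r : odd (ell (word_prod r)) = odd (size r).
Proof.
have [r' [e <-]] := has_reduced_word (word_prod r).
by apply: word_equiv_odd; apply/word_piP; rewrite -!word_prodE.
Qed.

(** Subadditivity bounds the change of length by one, and parity rules out equality. *)
Lemma ell_mul_sgen w i :
  ell (w * sgen i)%g = (ell w).+1 \/ ell w = (ell (w * sgen i)%g).+1.
Proof.
have := ell_mul w (sgen i); have := ell_mul (w * sgen i)%g (sgen i).
rewrite sgenK ell_sgen.
have : odd (ell (w * sgen i)%g) = ~~ odd (ell w).
  rewrite -(word_prod_repr w) -word_prod1 -word_prod_cat !odd_ell.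
  by rewrite size_cat addn1.
lia.
Qed.

Lemma ell_last_letter w : (0 < ell w)%N ->
  exists v i, w = (v * sgen i)%g /\ ell w = (ell v).+1.
Proof.
have [r [e s]] := has_reduced_word w; case/lastP: r => [|r i] in e s *.
  by rewrite -s.
move=> _; exists (word_prod r), i.
have e' : w = (word_prod r * sgen i)%g by rewrite -e -cats1 word_prod_cat word_prod1.
split=> //; have := ell_word_prod r; have := ell_mul (word_prod r) (sgen i).
by rewrite -e' ell_sgen -s size_rcons; lia.
Qed.

Lemma reduced_word_suffix r1 r2 :
  ell (word_prod (r1 ++ r2)) = size (r1 ++ r2) -> ell (word_prod r2) = size r2.
Proof.
rewrite word_prod_cat size_cat.
have := ell_mul (word_prod r1) (word_prod r2).
by have := ell_word_prod r1; have := ell_word_prod r2; lia.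
Qed.

Lemma ell_eq0 w : ell w = 0%N -> w = 1%g.
Proof.
have [r [<- <-]] := has_reduced_word w => /size0nil->; exact: word_prod_nil.
Qed.

Lemma word_prodV r : ((word_prod r)^-1)%g = word_prod (rev r).
Proof.
elim: r => [|i r IH]; first by rewrite word_prod_nil invg1.
by rewrite word_prod_cons invgM sgenV IH rev_cons -cats1 word_prod_cat word_prod1.
Qed.

Lemma ellV w : ell (w^-1)%g = ell w.
Proof.
have le (v : affW k) : (ell (v^-1)%g <= ell v)%N.
  have [r [<- <-]] := has_reduced_word v.
  by rewrite word_prodV -(size_rev r) ell_word_prod.
by apply/eqP; rewrite eqn_leq le -{1}(invgK w) le.
Qed.

End Length.

(** * Positive roots, their coroots and the reflections they define *)

Section RootSystem.
Variable k : nat.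
Implicit Types (u w : affW k) (i h : 'I_k.+1) (r : seq 'I_k.+1).
Implicit Types (lam : weight k) (mu : coweight k).

Lemma weight_actB u : {morph weight_act u : x y / x - y}.
Proof.
move=> x y; rewrite /weight_act /weyl_act.
elim: (repr u) => [//|i r IH] /=; rewrite IH /refl pairingBr mulrzBr.
by rewrite !opprD !opprK addrACA.
Qed.

Lemma coweight_actB u : {morph coweight_act u : x y / x - y}.
Proof.
move=> x y; rewrite /coweight_act /weyl_act.
elim: (repr u) => [//|i r IH] /=; rewrite IH /refl pairingBl mulrzBr.
by rewrite !opprD !opprK addrACA.
Qed.

HB.instance Definition _ u :=
  GRing.isZmodMorphism.Build (coweight k) (coweight k) (coweight_act u)
    (coweight_actB u).

HB.instance Definition _ u :=
  GRing.isZmodMorphism.Build (weight k) (weight k) (weight_act u) (weight_actB u).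

HB.instance Definition _ mu :=
  GRing.isZmodMorphism.Build (weight k) int (pairing mu) (pairingBr mu).

Lemma pairingDl mu mu' lam : pairing (mu + mu') lam = pairing mu lam + pairing mu' lam.
Proof.
by rewrite /pairing -big_split; apply: eq_bigr => x _; rewrite ffunE mulrDl.
Qed.

Lemma pairingMzl mu n lam : pairing (mu *~ n) lam = pairing mu lam * n.
Proof.
rewrite /pairing mulr_suml; apply: eq_bigr => x _.
by rewrite ffunMzE mulrzz mulrAC.
Qed.

Hypothesis k_gt0 : (0 < k)%N.

Lemma weight_act1 lam : weight_act 1%g lam = lam.
Proof.
rewrite -word_prod_nil; apply: (@weyl_act_word _ _ _ _ _ _ _ _ [::]).
- by move=> h; exact: pairingBr.
- by move=> i; rewrite pairing_root cartan_diag.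
- by move=> i h; rewrite pairing_root; exact: cartan_nonadj.
- by move=> i h; rewrite pairing_root; exact: cartan_adj.
Qed.

Lemma coweight_act1 mu : coweight_act 1%g mu = mu.
Proof.
rewrite -word_prod_nil.
apply: (@weyl_act_word _ _ _ (fun i mu => pairing mu (simple_root i)) _ _ _ _ [::]).
- by move=> h; exact: pairingBl.
- by move=> i; rewrite pairing_root cartan_diag.
- by move=> i h; rewrite pairing_root cartan_sym; exact: cartan_nonadj.
- by move=> i h; rewrite pairing_root cartan_sym; exact: cartan_adj.
Qed.

Lemma pairing_sgen i mu lam :
  pairing (coweight_act (sgen i) mu) lam = pairing mu (weight_act (sgen i) lam).
Proof.
rewrite coweight_act_sgen// weight_act_sgen// pairingBl raddfB raddfMz.
by rewrite pairingMzl mulrzz mulrC.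
Qed.

Lemma pairing_act w mu lam :
  pairing (coweight_act w mu) lam = pairing mu (weight_act (w^-1)%g lam).
Proof.
rewrite -(word_prod_repr w); elim: (repr w) mu lam => [|i r IH] mu lam.
  by rewrite word_prod_nil invg1 coweight_act1 weight_act1.
rewrite word_prod_cons invgM sgenV coweight_actM// weight_actM//.
by rewrite pairing_sgen IH.
Qed.

Lemma pairing_act2 w mu lam :
  pairing (coweight_act w mu) (weight_act w lam) = pairing mu lam.
Proof. by rewrite pairing_act -weight_actM// mulVg weight_act1. Qed.

Lemma weight_act_conj u i lam :
  weight_act (u * sgen i * u^-1)%g lam =
  lam - weight_act u (simple_root i) *~
          pairing (coweight_act u (simple_coroot i)) lam.
Proof.
rewrite !weight_actM// weight_act_sgen// raddfB raddfMz /= -weight_actM//.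
by rewrite mulgV weight_act1 pairing_act.
Qed.

(** The delta coordinate sees only alpha_0, so [c ord0] vanishes. If [c i] vanishes, row i of the
    Cartan matrix contributes only nonpositive terms, with a negative entry at [ordS i]; so
    [c (ordS i)] vanishes, and zero travels round the cycle. *)
Lemma simple_root_sum_eq0 (c : 'I_k.+1 -> nat) :
  \sum_i simple_root i *+ c i = 0 -> forall i, c i = 0%N.
Proof.
move=> e.
have ev x : \sum_i (simple_root i x *+ c i) = 0.
  have := congr1 (fun f : weight k => f x) e.
  rewrite sum_ffunE ffunE => {2}<-; by apply: eq_bigr => i _; rewrite ffunMnE.
have c0 : c ord0 = 0%N.
  have := ev None; rewrite (bigD1 ord0)//= ffunE /= big1 ?addr0 => [|i /negbTE ne].
    by lia.
  by rewrite ffunE ne mul0rn.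
have cS i : c i = 0%N -> c (ordS i) = 0%N.
  move=> ci; have /psumr_eq0P H : \sum_h - (simple_root h (Some i) *+ c h) = 0.
    by rewrite sumrN ev oppr0.
  have /H/(_ (ordS i) isT) : forall h, true -> 0 <= - (simple_root h (Some i) *+ c h).
    move=> h _; have [->|/negbTE hi] := eqVneq h i; first by rewrite ci mulr0n oppr0.
    by rewrite ffunE /cartan eq_sym hi -mulNrn mulrn_wge0//; case: eqP; case: eqP.
  rewrite ffunE /cartan eqxx ordS_neq//=.
  by case: eqP => _; lia.
move=> i; have : forall n, (n < k.+1)%N -> c (inord n) = 0%N.
  elim=> [_|n IH nk]; first by rewrite (_ : inord 0 = ord0)//; apply: val_inj; rewrite /= inordK.
  rewrite (_ : inord _ = ordS (inord n)) ?cS ?IH//; first exact: ltnW.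
  by apply: val_inj; rewrite /= !inordK ?modn_small//; exact: ltnW.
by move/(_ i (ltn_ord i)); rewrite inord_val.
Qed.

Lemma nonneg_root_anti lam : nonneg_root lam -> nonneg_root (- lam) -> lam = 0.
Proof.
move=> [c ec] [c' ec'].
have e : \sum_i simple_root i *+ (c i + c' i) = 0.
  under eq_bigr do rewrite mulrnDr; rewrite big_split /= -ec -ec'; exact: subrr.
rewrite ec big1// => i _; have := simple_root_sum_eq0 e i.
by case: (c i) => [|n]; [rewrite mulr0n|lia].
Qed.

Lemma cartan_le0 i h : i != h -> cartan i h <= 0.
Proof. by rewrite /cartan => /negbTE->; case: eqP; case: eqP. Qed.

(* A root and its coroot have the same coordinates in the bases of simple roots
   and simple coroots since the Cartan matrix is symmetric. *)
Definition nonneg_pair lam mu : Prop := exists c : 'I_k.+1 -> nat,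
  lam = \sum_i simple_root i *+ c i /\ mu = \sum_i simple_coroot i *+ c i.

Lemma nonneg_pairD lam mu lam' mu' :
  nonneg_pair lam mu -> nonneg_pair lam' mu' -> nonneg_pair (lam + lam') (mu + mu').
Proof.
move=> [c [-> ->]] [c' [-> ->]]; exists (fun i => (c i + c' i)%N).
by split; rewrite -big_split; apply: eq_bigr => i _; rewrite mulrnDr.
Qed.

Lemma nonneg_pairMn lam mu n :
  nonneg_pair lam mu -> nonneg_pair (lam *+ n) (mu *+ n).
Proof.
move=> [c [-> ->]]; exists (fun i => (c i * n)%N).
by split; rewrite -sumrMnl; apply: eq_bigr => i _; rewrite mulrnA.
Qed.

Lemma nonneg_pair_simple i : nonneg_pair (simple_root i) (simple_coroot i).
Proof.
exists (fun h => (h == i) : nat).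
by split; rewrite (bigD1 i)//= eqxx big1 ?addr0// => h /negbTE->.
Qed.

Lemma nonneg_pair_root lam mu : nonneg_pair lam mu -> nonneg_root lam.
Proof. by move=> [c [-> _]]; exists c. Qed.

Lemma nonneg_pair_pairing lam mu j :
  nonneg_pair lam mu -> 0 <= pairing mu (fund_weight j).
Proof.
move=> [c [_ ->]]; rewrite /pairing sumr_ge0// => x _.
rewrite sum_ffunE mulr_ge0 ?ffunE// sumr_ge0// => i _.
by rewrite ffunMnE ffunE mulrn_wge0.
Qed.

Lemma weight_act_rootM w t s : weight_act (w * sgen t)%g (simple_root s) =
  weight_act w (simple_root s) - weight_act w (simple_root t) *~ cartan t s.
Proof. by rewrite weight_actM// weight_act_sgen// pairing_root raddfB raddfMz. Qed.

Lemma coweight_act_corootM w t s : coweight_act (w * sgen t)%g (simple_coroot s) =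
  coweight_act w (simple_coroot s) - coweight_act w (simple_coroot t) *~ cartan t s.
Proof.
by rewrite coweight_actM// coweight_act_sgen// pairing_root cartan_sym raddfB raddfMz.
Qed.

Lemma cartan_rank1 i h : k = 1%N -> i != h -> cartan i h = - Posz 2.
Proof.
move=> k1; rewrite /cartan -!val_eqE /=; case: i h => i hi [h hh] /=.
by rewrite k1 in hi hh *; case: i hi => [|[|]]//; case: h hh => [|[|]].
Qed.

(** With no braid relation for [k = 1], the rank-one case rests on the null root and the central
    coweight: they pair to zero with all simple coroots, respectively roots, hence are fixed. *)
Lemma act_delta_rank1 w s t : k = 1%N -> s != t ->
  weight_act w (simple_root s + simple_root t) = simple_root s + simple_root t /\
  coweight_act w (simple_coroot s + simple_coroot t) =
    simple_coroot s + simple_coroot t.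
Proof.
move=> k1 st; have cst := cartan_rank1 k1 st.
have cl l : cartan l s + cartan l t = 0.
  have [->|ls] := eqVneq l s; first by rewrite cst cartan_diag.
  have [->|lt] := eqVneq l t; first by rewrite cartan_sym cst cartan_diag.
  exfalso; move: ls lt st; rewrite -!val_eqE /=.
  by move: (ltn_ord l) (ltn_ord s) (ltn_ord t); lia.
rewrite -(word_prod_repr w); elim: (repr w) => [|l r [IH1 IH2]].
  by rewrite word_prod_nil weight_act1 coweight_act1.
rewrite word_prod_cons weight_actM// coweight_actM// IH1 IH2.
rewrite weight_act_sgen// coweight_act_sgen// raddfD /= !pairing_root cl.
by rewrite pairingDl !pairing_root (cartan_sym s) (cartan_sym t) cl !mulr0z !subr0.
Qed.

(* Induction on the length: if w = v t, then w (alpha_s) is a combination of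
   v (alpha_s) and v (alpha_t), and the braid relation deals with the case where
   v s is shorter than v. *)
Lemma nonneg_pair_act w s : ell (w * sgen s)%g = (ell w).+1 ->
  nonneg_pair (weight_act w (simple_root s)) (coweight_act w (simple_coroot s)).
Proof.
have [n le] := ubnP (ell w); elim: n => // n IH in w s le *; move=> ws.
have [w0|/ell_last_letter[v [t [wE wl]]]] := posnP (ell w).
  rewrite (ell_eq0 w0) weight_act1 coweight_act1; exact: nonneg_pair_simple.
have ts : t != s by apply/negP => /eqP e; move: ws; rewrite wl wE e sgenK; lia.
have vt : nonneg_pair (weight_act v (simple_root t)) (coweight_act v (simple_coroot t)).
  by apply: IH; rewrite -?wE//; lia.
rewrite wE weight_act_rootM coweight_act_corootM.
have [vs|vs] := ell_mul_sgen v s.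
  have {}vs : nonneg_pair (weight_act v (simple_root s)) (coweight_act v (simple_coroot s)).
    by apply: IH; first lia.
  have [m ->] : exists m, cartan t s = - (Posz m).
    by exists `|cartan t s|%N; have := cartan_le0 ts; lia.
  rewrite !subr_mulrzN; exact: (nonneg_pairD vs (nonneg_pairMn m vt)).
have [k1|kle1] := ltnP 1 k; last first.
  have k1 : k = 1%N by lia.
  (* v(alpha_s) + 2 v(alpha_t) is the fixed vector alpha_s + alpha_t plus v(alpha_t). *)
  rewrite (cartan_rank1 k1 ts) !subr_mulrzN.
  have st : s != t by rewrite eq_sym.
  have [] := act_delta_rank1 v k1 st; rewrite !raddfD /= !mulr2n !addrA => -> ->.
  by do 2?apply: nonneg_pairD => //; exact: nonneg_pair_simple.
have [v1 vE] : exists v1, v = (v1 * sgen s)%g by exists (v * sgen s)%g; rewrite sgenK.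
have {}vs : ell v = (ell v1).+1 by move: vs; rewrite [in X in _ = X]vE sgenK.
have [adj|nadj] := boolP (adjacent t s); last first.
  (* As s and t commute, w s = v1 t would be shorter than w. *)
  exfalso; have wsE : (w * sgen s)%g = (v1 * sgen t)%g.
    by rewrite wE vE -(mulgA _ (sgen t)) sgen_comm// mulgA sgenK.
  by have := ell_mul v1 (sgen t); rewrite -wsE ell_sgen; lia.
have [v1t|v1t] := ell_mul_sgen v1 t.
  (* Here w(alpha_s) = v1 s t(alpha_s) = v1(alpha_t). *)
  have := IH v1 t ltac:(lia) v1t.
  rewrite vE !weight_act_rootM !coweight_act_corootM cartan_diag//.
  have cst := cartan_adj k_gt0 k1 adj; rewrite (cartan_sym s t) !cst.
  move: (weight_act v1 _) (weight_act v1 _) (coweight_act v1 _) (coweight_act v1 _).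
  by move=> a b c d; rewrite (reflectK a) (reflectK c).
have [v2 v1E] : exists v2, v1 = (v2 * sgen t)%g.
  by exists (v1 * sgen t)%g; rewrite sgenK.
have {}v1t : ell v1 = (ell v2).+1 by move: v1t; rewrite [in X in _ = X]v1E sgenK.
(* w = v2 t s t = v2 s t s ends in s, so w s would be shorter than w. *)
have wsE : (w * sgen s)%g = (v2 * sgen s * sgen t)%g.
  rewrite wE vE v1E -(mulgA v2) -(mulgA v2) sgen_braid//.
  by rewrite !mulgA sgenK.
have := ell_mul (v2 * sgen s)%g (sgen t); have := ell_mul v2 (sgen s).
by rewrite -wsE !ell_sgen; lia.
Qed.

Lemma pairing_delta mu x : pairing mu [ffun y => (y == x)%:Z] = mu x.
Proof.
rewrite /pairing (bigD1 x)//= ffunE eqxx mulr1 big1 ?addr0// => y /negbTE yx.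
by rewrite ffunE yx mulr0.
Qed.

(** The reflection formula gives <c,lam> b = <c',lam> b' for all lam, so the roots are integer
    multiples of each other, hence equal up to sign; positivity fixes the sign. *)
Lemma reflection_coroot u i u' i' :
  (u * sgen i * u^-1)%g = (u' * sgen i' * u'^-1)%g ->
  nonneg_root (weight_act u (simple_root i)) ->
  nonneg_root (weight_act u' (simple_root i')) ->
  coweight_act u (simple_coroot i) = coweight_act u' (simple_coroot i').
Proof.
move=> e; set b := weight_act u _; set b' := weight_act u' _ => pb pb'.
set c := coweight_act u _; set c' := coweight_act u' _.
have H lam : b *~ pairing c lam = b' *~ pairing c' lam.
  have := weight_act_conj u i lam; rewrite e weight_act_conj.
  by move/addrI/oppr_inj.
have cb : pairing c b = 2 by rewrite pairing_act2 pairing_root cartan_diag.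
have [m bE] : exists m, b = b' *~ m.
  (* [c] takes the value 1 on u(Lambda_i). *)
  exists (pairing c' (weight_act u (fund_weight i))); rewrite -H.
  by rewrite pairing_act2 pairing_fund eqxx.
have [m' b'E] : exists m', b' = b *~ m'.
  exists (pairing c (weight_act u' (fund_weight i'))); rewrite H.
  by rewrite pairing_act2 pairing_fund eqxx.
have mm : m' * m = 1.
  by have := cb; rewrite {1}bE {1}b'E -mulrzA raddfMz /= cb mulrzz; lia.
have {}mm : m = 1 \/ m = - 1.
  have : (`|m'| * `|m| == 1)%N by rewrite -abszM mm.
  by rewrite muln_eq1 => /andP[_ /eqP]; lia.
case: mm => mE; last first.
  have b0 : b = 0.
    apply: nonneg_root_anti => //; suff <- : b' = - b by [].
    by rewrite bE mE mulrNz opprK.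
  by move: cb; rewrite b0 raddf0.
rewrite mE mulr1z in bE; apply/ffunP => x; rewrite -(pairing_delta c) -(pairing_delta c').
(* Pairing with [c] turns the common root into the factor 2, which cancels. *)
have := congr1 (pairing c) (H [ffun y => (y == x)%:Z]).
rewrite -bE !raddfMz /= cb !mulrzz; lia.
Qed.

(** Uniqueness of the positive coroot makes the choice of [xget] immaterial. *)
Lemma cover_corootE z w mu : is_cover_coroot z w mu -> cover_coroot z w = mu.
Proof.
move=> h; rewrite /cover_coroot; case: xgetP => [_ ->|/(_ _ h)//].
move: h => [u [i [e p ->]]] [u' [i' [e' p' ->]]].
by apply: reflection_coroot => //; rewrite -e -e'.
Qed.

End RootSystem.

(** * Charges of cores as fundamental coordinates of weights *)

Section Cores.
Variable k : nat.
Hypothesis k_gt0 : (0 < k)%N.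
Implicit Types (i h j : 'I_k.+1) (lam : intpart).

Lemma ordSE i : ordS i = i + inZp 1.
Proof. by apply: val_inj; rewrite /= modnDmr addn1. Qed.

Lemma residueS a b : residue k (a, b.+1) = ordS (residue k (a, b)).
Proof.
rewrite ordSE /residue /= addrAC; congr (_ - _); apply: val_inj.
by rewrite /= modnDm addn1.
Qed.

Lemma residueSS a b : residue k (a.+1, b.+1) = residue k (a, b).
Proof. by apply/eq_residue; rewrite addSnnS. Qed.

(** Subtracting j rotates the Dynkin diagram, which reduces Lambda_j to Lambda_0. *)
Lemma cartanB i h j : cartan (i - j) (h - j) = cartan i h.
Proof. by rewrite /cartan !ordSE !(addrAC _ (- j)) !(inj_eq (addIr _)). Qed.

Definition charge lam h : int :=
  (size (addable_cells h lam))%:Z - (size (removable_cells h lam))%:Z.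

(** The cell (a+1, b) stands in for the last cell (a, b-1) of the row: it has the same residue and
    also makes sense for an empty row. *)
Definition boundary h a b : int :=
  (residue k (a, b) == h)%:Z - (residue k (a.+1, b) == h)%:Z.

(** The bound is strict because the empty row just below the diagram carries an addable cell. *)
Lemma size_addable_cells h lam N : (size lam < N)%N ->
  size (addable_cells h lam) =
  (\sum_(0 <= a < N) ((a, part_row lam a) \in addable_cells h lam))%N.
Proof.
move=> sN; rewrite (big_cat_nat (leq0n _) sN) /= [X in (_ + X)%N]big_nat.
rewrite [X in (_ + X)%N]big1 ?addn0; last first.
  move=> [//|a] /andP[sa _]; rewrite mem_addable_cells /addable /=.
  by rewrite [part_row lam a]row_default// ltn0 andbF.
rewrite size_filter count_map -sum1_count big_mkcond /index_iota subn0.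
by apply: eq_bigr => a _; rewrite mem_addable_cells /=; case: ifP.
Qed.

Lemma size_removable_cells h lam N : (size lam <= N)%N ->
  size (removable_cells h lam) =
  (\sum_(0 <= a < N) ((a, (part_row lam a).-1) \in removable_cells h lam))%N.
Proof.
move=> sN; rewrite (big_cat_nat (leq0n _) sN) /= [X in (_ + X)%N]big_nat.
rewrite [X in (_ + X)%N]big1 ?addn0; last first.
  by move=> a /andP[sa _]; rewrite mem_removable_cells /removable /= [part_row lam a]row_default.
rewrite size_filter count_map -sum1_count big_mkcond /index_iota subn0.
by apply: eq_bigr => a _; rewrite mem_removable_cells /=; case: ifP.
Qed.

(* Reading the boundary of lam row by row: rows of equal length contribute two
   opposite terms, which cancel. *)
Lemma chargeE lam h N : (size lam <= N)%N ->
  charge lam h =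
  \sum_(0 <= a < N) boundary h a (part_row lam a) + (residue k (N, 0%N) == h)%:Z.
Proof.
move=> sN; rewrite /charge (size_addable_cells h (N := N.+1))//.
rewrite (size_removable_cells h sN) big_nat_recl// mem_addable_cells /=.
rewrite {1}/addable /= eqxx /=; set f := part_row lam.
(* Shifting the positive terms by one row compares the end of row a with the addable position of row
   a+1. *)
have -> : \sum_(0 <= a < N) boundary h a (f a) + (residue k (N, 0%N) == h)%:Z =
  (residue k (0%N, f 0%N) == h)%:Z + \sum_(0 <= a < N)
    ((residue k (a.+1, f a.+1) == h)%:Z - (residue k (a.+1, f a) == h)%:Z).
  have fN : f N = 0%N by exact: row_default.
  rewrite /boundary !sumrB addrAC [in RHS]addrA; congr (_ - _).
  by rewrite -(big_nat_recl N 0 (fun a => (residue k (a, f a) == h)%:Z))// big_nat_recr//= fN.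
rewrite PoszD -addrA; congr (_ + _).
rewrite !(big_morph Posz PoszD (erefl _)) -sumrB; apply: eq_bigr => a _.
rewrite mem_addable_cells mem_removable_cells /addable /removable /= -/f eqxx /=.
have := row_anti lam (leqnSn a); rewrite -/f leq_eqVlt => /orP[/eqP->|lt].
  by rewrite ltnn subrr; case: (f a) => [|x] //=; rewrite ltnn !andbF.
case: (f a) lt => [//|x] /=; rewrite ltnS => lt.
by rewrite lt eqxx /= residueSS.
Qed.

(** Three consecutive residues are involved, and their second difference is minus a row of the
    Cartan matrix. *)
Lemma boundaryS h a b :
  boundary h a b.+1 = boundary h a b - cartan (residue k (a, b)) h.
Proof.
rewrite /boundary residueSS residueS -(residueSS a b) residueS.
rewrite /cartan (inj_eq (@ordS_inj _)) (eq_sym h).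
by case: (_ == h); case: (_ == h); case: (_ == h).
Qed.

Lemma charge_add_cells i h lam : charge (add_cells i lam) h =
  charge lam h - cartan i h * (size (addable_cells i lam))%:Z.
Proof.
pose N := (size lam + size (add_cells i lam)).+1.
rewrite !(chargeE h (N := N)) ?(@size_addable_cells i lam N)/N; try lia.
rewrite addrAC; congr (_ + _).
rewrite !(big_morph Posz PoszD (erefl _)) mulr_sumr -sumrB; apply: eq_bigr => a _.
rewrite row_add_cells /add_row.
have [|_] := boolP (_ \in _); last by rewrite addn0 mulr0 subr0.
by rewrite mem_addable_cells => /andP[_ /eqP<-]; rewrite addn1 boundaryS mulr1.
Qed.

Lemma charge_remove_cells i h lam : charge (remove_cells i lam) h =
  charge lam h + cartan i h * (size (removable_cells i lam))%:Z.
Proof.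
pose N := (size lam + size (remove_cells i lam)).+1.
rewrite !(chargeE h (N := N)) ?(@size_removable_cells i lam N)/N; try lia.
rewrite addrAC; congr (_ + _).
rewrite !(big_morph Posz PoszD (erefl _)) mulr_sumr -big_split /=; apply: eq_bigr => a _.
rewrite row_remove_cells /remove_row.
have [|_] := boolP (_ \in _); last by rewrite subn0 mulr0 addr0.
rewrite mem_removable_cells /removable /= => /andP[/andP[/eqP + _] /eqP<-].
by case: (part_row lam a) => // b _; rewrite /= subn1 boundaryS mulr1 subrK.
Qed.

Lemma flush_iter n f m : flush n f ->
  forall p, exists q, (f q + p + m * n = f p + q)%N.
Proof.
move=> fl; elim: m => [|m IH] p; first by exists p; lia.
by have [q hq] := IH p; have [r hr] := fl q; exists r; lia.
Qed.

(* In terms of the beads part_row lam a - a: moving the removable bead down, or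
   the addable one up, by one step reaches a free position of the same runner,
   while on each runner of a core the beads fill everything below the top one. *)
Lemma core_addable_removable i lam : is_core k.+1 lam ->
  (addable_cells i lam == [::]) || (removable_cells i lam == [::]).
Proof.
move=> /flushP-/(_ isT) fl; apply/norP => -[].
case E1: (addable_cells i lam) => [//|[q b'] s1] _.
case E2: (removable_cells i lam) => [//|[p b] s2] _.
have : (q, b') \in addable_cells i lam by rewrite E1 mem_head.
have : (p, b) \in removable_cells i lam by rewrite E2 mem_head.
rewrite mem_addable_cells mem_removable_cells /addable /removable /=.
have fA := row_anti lam; set f := part_row lam in fl fA *.
move=> /andP[/andP[/eqP fp fp1] /eqP<-] /andP[/andP[/eqP-> fq] /eqP/eq_residue].
(* Going down m steps from the higher bead gives a row r whose bead sits just above that of row q,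
   or just below that of row p; both places are free. *)
case/orP: (leq_total (f q + p) (b + q)) => le /eqP.
  rewrite eq_sym eqn_mod_dvd// => /dvdnP[m hm]; have [r hr] := flush_iter m fl p.
  have [qr|rq] := leqP q r; first by have := fA _ _ qr; lia.
  by have := fA r q.-1 ltac:(lia); case/orP: fq; lia.
rewrite eqn_mod_dvd// => /dvdnP[m hm]; have [r hr] := flush_iter m fl q.
have [rp|pr] := leqP r p; first by have := fA _ _ rp; lia.
by have := fA p.+1 r pr; lia.
Qed.

(** In a core one of the two cell lists at i is empty, so [charge lam i] is the signed number of
    cells that s_i moves. *)
Lemma charge_act i h lam : is_core k.+1 lam ->
  charge (intpart_act i lam) h = charge lam h - cartan i h * charge lam i.
Proof.
move=> /(core_addable_removable i) ar; rewrite /intpart_act [charge lam i]/charge.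
case: eqP ar => [-> _|_ /= /eqP->]; last by rewrite charge_add_cells subr0.
case: eqP => [->|_]; first by rewrite subrr mulr0 subr0.
by rewrite charge_remove_cells sub0r mulrN opprK.
Qed.

Lemma charge_empty h : charge empty_partition h = (h == ord0)%:Z.
Proof.
rewrite (chargeE h (N := 0)) ?big_geq// add0r eq_sym; congr (_ == _)%:Z.
by rewrite /residue subrr; exact: val_inj.
Qed.

(** Both sides start with the coordinates of Lambda_j, those of the empty core shifted by j, and
    each letter changes them by the same formula. *)
Lemma weight_act_fund_charge r j h :
  weight_act (word_prod r) (fund_weight j) (Some h) =
  charge (sval (kcore_word k_gt0 [seq x - j | x <- r])) (h - j).
Proof.
elim: r h => [|i r IH] h.
  rewrite word_prod_nil weight_act1// ffunE charge_empty.
  by rewrite (_ : ord0 = 0)// subr_eq0.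
rewrite word_prod_cons weight_actM// weight_act_sgen// !ffunE ffunMzE ffunE.
rewrite pairing_coroot !IH mulrzz /=.
by rewrite charge_act; [rewrite cartanB cartan_sym|exact: svalP].
Qed.

End Cores.

(** * The coefficients of the down operator *)

Lemma is_down_coefE k (k_gt0 : (0 < k)%N) (w z : affW k) j n :
  is_down_coef k_gt0 w j z n ->
  pairing (cover_coroot z w) (fund_weight j) = n%:Z.
Proof.
move=> [r1 [i [r2 [[wE ws] [zE zs] nE]]]].
pose b := word_prod r2.
have lb : ell (word_prod (i :: r2)) = (ell b).+1.
  rewrite /b (@reduced_word_suffix _ (r1 ++ [:: i]) r2) -?catA /= ?wE//.
  by rewrite (@reduced_word_suffix _ r1 (i :: r2)) // wE.
have pos : nonneg_pair (weight_act (b^-1)%g (simple_root i))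
                       (coweight_act (b^-1)%g (simple_coroot i)).
  apply: nonneg_pair_act => //.
  by rewrite -[X in (_ * X)%g]sgenV -invgM !ellV -lb word_prod_cons.
have cE : is_cover_coroot z w (coweight_act (b^-1)%g (simple_coroot i)).
  exists (b^-1)%g, i; split=> //; last exact: nonneg_pair_root pos.
  rewrite -wE -zE !word_prod_cat word_prod_cons -/b invgM invgK !mulgA.
  by rewrite -(mulgA _ (_^-1)%g) mulVg mulg1.
have := nonneg_pair_pairing j pos; rewrite (cover_corootE k_gt0 cE).
rewrite pairing_act// invgK pairing_coroot weight_act_fund_charge /charge -nE.
set lam := sval _.
have : is_core k.+1 lam by exact: svalP.
(* Without addable cells the charge is minus the number of removable ones; being nonnegative, it is
   0, which is again the count. *)
move=> /(core_addable_removable k_gt0 (i - j)) /orP[]/eqP e; last by rewrite e subr0.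
by move: nE; rewrite -/lam e => -> /=; lia.
Qed.

(** The lengths differ by one, so the reduced subword arises by deleting a single letter. *)
Lemma bruhat_cover_down_coef k (k_gt0 : (0 < k)%N) (w z : affW k) j :
  bruhat_cover z w -> exists n, is_down_coef k_gt0 w j z n.
Proof.
move=> [[_ [rz [rw [[zE zs] [wE ws] sub]]]] lw].
have [r1 [i [r2 [e1 e2]]]] : exists r1 i r2, rw = r1 ++ i :: r2 /\ rz = r1 ++ r2.
  have sz : size rw = (size rz).+1 by rewrite zs ws.
  elim: rw rz sub sz {zE zs wE ws} => [//|x rw IH] [|y rz] /=.
    by move=> _ [/size0nil->]; exists [::], x, [::].
  case: eqP => [<- sub [sz]|_ sub [sz]].
    by have [r1 [i [r2 [-> ->]]]] := IH rz sub sz; exists (y :: r1), i, r2.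
  exists [::], x, rw; split=> //; apply/eqP.
  by rewrite -(size_subseq_leqif sub) sz.
by eexists; exists r1, i, r2; split; [rewrite -e1|rewrite -e2|].
Qed.

Theorem theorem3p11 (R : comNzRingType) (k : nat) (k_gt0 : (0 < k)%N)
    (j : 'I_k.+1) (w : affW k) (w_min : min_coset_rep j w) :
  (forall z, bruhat_cover z w -> exists! n, is_down_coef k_gt0 w j z n) /\
  (forall c : affW k -> nat,
     (forall z, bruhat_cover z w -> is_down_coef k_gt0 w j z (c z)) ->
     down_op (fund_weight j) (nilcox_basis R w) =
       \sum_(z \in [set z | bruhat_cover z w]) (c z)%:R *: nilcox_basis R z).
Proof.
split=> [z /(bruhat_cover_down_coef k_gt0 j)[n hn]|c hc].
  (* Every choice of reduced word computes the same pairing, hence the same count. *)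
  exists n; split=> // m hm.
  by have := is_down_coefE hm; rewrite (is_down_coefE hn) => -[].
rewrite /down_op liftU scale1r; apply: eq_fsbigr => z /set_mem/hc/is_down_coefE->.
by [].
Qed.
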